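(* Let $\mathrm{d}\Pi_0$, $\mathrm{d}E$, $\mathrm{d}R$ be (signed) Lebesgue–Stieltjes measures supported on $[1,\infty)$ and put $\mathrm{d}\Pi=\mathrm{d}\Pi_0+\mathrm{d}E+\mathrm{d}R$. Assume: (i) there is $a>0$ such that $M_0(x):=\int_{1^-}^{x}\exp^{\ast}(-\mathrm{d}\Pi_0)=O\!\left(\frac{x}{\log^{a}x}\right)$ as $x\to\infty$; (ii) $\int_{1^-}^{x}|\mathrm{d}E(u)|=o\!\left(\frac{x}{\log x}\right)$ as $x\to\infty$; (iii) $\int_{1^-}^{\infty}\frac{|\mathrm{d}R(u)|}{u}<\infty$. Then $M(x):=\int_{1^-}^{x}\exp^{\ast}(-\mathrm{d}\Pi)=o(x)$ as $x\to\infty$.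
   Context: All measures are locally finite signed Borel measures on $[1,\infty)$; their primitives are right-continuous and supported on $[1,\infty)$. The notation $\int_{1^-}^{x}$ means integration over $[1,x]$. $|\mathrm{d}A|$ denotes the total variation measure of $\mathrm{d}A$. The (multiplicative) convolution of measures is defined by $\int_{1^-}^{x}\mathrm{d}A\ast\mathrm{d}B=\iint_{1\le uv\le x}\mathrm{d}A(u)\,\mathrm{d}B(v)$, and $\exp^{\ast}(\mathrm{d}A)=\sum_{n=0}^{\infty}\frac{1}{n!}\mathrm{d}A^{\ast n}$, where $\mathrm{d}A^{\ast 0}=\delta_1$ is the Dirac measure at $1$. *)

(* Defs.v *)
From HB Require Import structures.
From mathcomp Require Import all_boot all_order all_algebra.
From mathcomp Require Import all_classical all_reals all_analysis.
From mathcomp Require Import measurable_realfun charge.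

Set Implicit Arguments.
Unset Strict Implicit.
Unset Printing Implicit Defensive.

Import Order.TTheory GRing.Theory Num.Theory.
Import numFieldNormedType.Exports.

Local Open Scope classical_set_scope.
Local Open Scope ring_scope.
Local Open Scope ereal_scope.

(* Lets the Landau notations of the library be used at +oo. *)
Canonical pinfty_filter_on (R : numFieldType) :=
  FilterType (pinfty_nbhs R) _.

(* Positive locally finite measures on [1, +oo[, as Borel measures on R giving
   mass 0 to ]-oo, 1[. *)
Record lfmeasure (R : realType) := LFMeasure {
  lfm :> {measure set R -> \bar R} ;
  lfm_fin : forall x : R, lfm `[1%R, x]%classic < +oo ;
  lfm_supp : lfm `]-oo, 1%R[%classic = 0 }.

Section lfmeasure_theory.
Context {R : realType}.
Implicit Types m : lfmeasure R.

Lemma lfm_ray_fin m (x : R) : m `]-oo, x]%classic < +oo.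
Proof.
apply: (@le_lt_trans _ _ (m (`]-oo, 1%R[%classic `|` `[1%R, x]%classic))).
  apply: le_measure; rewrite ?inE//=; first exact: measurableU.
  move=> y /=; rewrite !in_itv/= => yx.
  by case: (ltP y 1%R) => y1; [left|right]; rewrite /= ?in_itv/= ?y1 ?yx.
apply: (le_lt_trans (measureU2 _ _ _)) => //=.
by rewrite lfm_supp add0e; exact: lfm_fin.
Qed.

Lemma lfm_sigma_finite m : sigma_finite setT m.
Proof.
exists (fun n : nat => `]-oo, n%:R : R]%classic).
  apply/esym/seteqP; split=> // x _.
  exists (Num.bound `|x|%R) => //=; rewrite in_itv/=.
  exact: le_trans (ler_norm x) (ltW (archi_boundP (normr_ge0 x))).
by move=> n; split => //; exact: lfm_ray_fin.
Qed.

Definition lfm_sf m : set R -> \bar R := m.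

HB.instance Definition _ m := Measure.on (lfm_sf m).
HB.instance Definition _ m :=
  Measure_isSigmaFinite.Build _ _ _ (lfm_sf m) (lfm_sigma_finite m).

Lemma lfm0_fin (x : R) : (@mzero _ R R) `[1%R, x]%classic < +oo.
Proof. exact: ltry. Qed.

Lemma lfm0_supp : (@mzero _ R R) `]-oo, 1%R[%classic = 0.
Proof. by []. Qed.

Definition lfm0 : lfmeasure R := LFMeasure lfm0_fin lfm0_supp.

Lemma lfm_dirac1_fin (x : R) : (@dirac _ R 1%R R) `[1%R, x]%classic < +oo.
Proof. by rewrite diracE ltry. Qed.

Lemma lfm_dirac1_supp : (@dirac _ R 1%R R) `]-oo, 1%R[%classic = 0.
Proof. by rewrite diracE memNset//= in_itv/= ltxx. Qed.

Definition lfm_dirac1 : lfmeasure R := LFMeasure lfm_dirac1_fin lfm_dirac1_supp.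

Lemma lfm_add_fin m1 m2 (x : R) : measure_add m1 m2 `[1%R, x]%classic < +oo.
Proof. by rewrite measure_addE lte_add_pinfty//; exact: lfm_fin. Qed.

Lemma lfm_add_supp m1 m2 : measure_add m1 m2 `]-oo, 1%R[%classic = 0.
Proof. by rewrite measure_addE !lfm_supp adde0. Qed.

Definition lfm_add m1 m2 : lfmeasure R :=
  LFMeasure (lfm_add_fin m1 m2) (lfm_add_supp m1 m2).

Lemma lfm_addE m1 m2 (X : set R) : lfm_add m1 m2 X = m1 X + m2 X.
Proof. exact: measure_addE. Qed.

(* The convolution is the image of the product measure under (u, v) |-> uv. *)
Definition mulRR (z : R * R) : R := (z.1 * z.2)%R.

Lemma measurable_mulRR : measurable_fun setT mulRR.
Proof. by apply: measurable_funM; [exact: measurable_fst|exact: measurable_snd]. Qed.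

Definition mconv m1 m2 : set R -> \bar R :=
  pushforward (m1 \x lfm_sf m2) mulRR.

Let mconv0 m1 m2 : mconv m1 m2 set0 = 0.
Proof. by rewrite /mconv /pushforward preimage_set0 measure0. Qed.

Let mconv_ge0 m1 m2 B : 0 <= mconv m1 m2 B.
Proof. by rewrite /mconv /pushforward measure_ge0. Qed.

Let mconv_sigma_additive m1 m2 : semi_sigma_additive (mconv m1 m2).
Proof.
exact: (@measure_semi_sigma_additive _ _ _
  (measure_function_pushforward__canonical__measure_function_Measure
    (m1 \x lfm_sf m2) measurable_mulRR)).
Qed.

HB.instance Definition _ m1 m2 := isMeasure.Build _ _ _ (mconv m1 m2)
  (mconv0 m1 m2) (@mconv_ge0 m1 m2) (@mconv_sigma_additive m1 m2).

Lemma mconv_null m1 m2 :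
  (m1 \x lfm_sf m2) (`]-oo, 1%R[ `*` setT `|` setT `*` `]-oo, 1%R[) = 0.
Proof.
have p1 : measurable (`]-oo, 1%R[ `*` [set: R] : set (R * R)) by exact: measurableX.
have p2 : measurable ([set: R] `*` `]-oo, 1%R[ : set (R * R)) by exact: measurableX.
apply/eqP; rewrite eq_le measure_ge0 andbT.
apply: (le_trans (measureU2 _ p1 p2)).
by rewrite /= !product_measure1E//= {1}/lfm_sf !lfm_supp mul0e mule0 adde0.
Qed.

Lemma mconv_le m1 m2 (x : R) :
  mconv m1 m2 `[1%R, x]%classic <= m1 `[1%R, x]%classic * m2 `[1%R, x]%classic.
Proof.
have p1 : measurable (`]-oo, 1%R[ `*` [set: R] : set (R * R)) by exact: measurableX.
have p2 : measurable ([set: R] `*` `]-oo, 1%R[ : set (R * R)) by exact: measurableX.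
have p3 : measurable (`[1%R, x] `*` `[1%R, x] : set (R * R)) by exact: measurableX.
have mf := measurable_mulRR measurableT (measurable_itv `[1%R, x]).
rewrite setTI in mf.
rewrite /mconv /pushforward.
apply: (@le_trans _ _ ((m1 \x lfm_sf m2) ((`[1%R, x] `*` `[1%R, x]) `|`
   (`]-oo, 1%R[ `*` setT `|` setT `*` `]-oo, 1%R[)))).
  apply: le_measure; rewrite ?inE//; first by do 2?apply: measurableU.
  move=> -[u v]; rewrite /mulRR/= in_itv/= => /andP[uv1 uvx].
  have [u1|u1] := ltP u 1%R; first by right; left; rewrite /= in_itv.
  have [v1|v1] := ltP v 1%R; first by right; right; rewrite /= in_itv.
  left; rewrite /= !in_itv/= u1 v1/=; split; apply: le_trans uvx.
    by rewrite ler_peMr// (le_trans _ u1).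
  by rewrite ler_peMl// (le_trans _ v1).
apply: (le_trans (measureU2 _ p3 (measurableU _ _ p1 p2))) => /=.
by rewrite mconv_null adde0 product_measure1E.
Qed.

Lemma mconv_fin m1 m2 (x : R) : mconv m1 m2 `[1%R, x]%classic < +oo.
Proof.
apply: (le_lt_trans (mconv_le m1 m2 x)).
by rewrite lte_mul_pinfty ?lfm_fin// ge0_fin_numE// lfm_fin.
Qed.

Lemma mconv_supp m1 m2 : mconv m1 m2 `]-oo, 1%R[%classic = 0.
Proof.
have p1 : measurable (`]-oo, 1%R[ `*` [set: R] : set (R * R)) by exact: measurableX.
have p2 : measurable ([set: R] `*` `]-oo, 1%R[ : set (R * R)) by exact: measurableX.
have mf := measurable_mulRR measurableT (measurable_itv `]-oo, 1%R[).
rewrite setTI in mf.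
apply/eqP; rewrite eq_le measure_ge0 andbT -(mconv_null m1 m2) /mconv /pushforward.
apply: le_measure; rewrite ?inE//; first exact: measurableU.
move=> -[u v]; rewrite /mulRR/= !in_itv/= => uv1.
have [u1|u1] := ltP u 1%R; first by left.
have [v1|v1] := ltP v 1%R; first by right.
by move: uv1; rewrite ltNge mulr_ege1.
Qed.

Definition lfm_conv m1 m2 : lfmeasure R :=
  LFMeasure (mconv_fin m1 m2) (mconv_supp m1 m2).

End lfmeasure_theory.

(* A locally finite signed measure on [1, +oo[ is a difference of two positive
   ones. The decomposition need not be the Jordan one. The value signed_val is
   meaningful on bounded Borel sets only: elsewhere it could be +oo - +oo. *)
Record smeasure (R : realType) := SMeasure {
  spos : lfmeasure R ;
  sneg : lfmeasure R }.

Section smeasure_theory.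
Context {R : realType}.
Implicit Types A B : smeasure R.

Definition signed_val A (X : set R) : R := (fine (spos A X) - fine (sneg A X))%R.

(* int_(1-)^x dA *)
Definition primitive A (x : R) : R := signed_val A `[1%R, x]%classic.

Definition sadd A B : smeasure R :=
  SMeasure (lfm_add (spos A) (spos B)) (lfm_add (sneg A) (sneg B)).

Definition sopp A : smeasure R := SMeasure (sneg A) (spos A).

Definition sdirac1 : smeasure R := SMeasure lfm_dirac1 lfm0.

Definition sconv A B : smeasure R :=
  SMeasure
    (lfm_add (lfm_conv (spos A) (spos B)) (lfm_conv (sneg A) (sneg B)))
    (lfm_add (lfm_conv (spos A) (sneg B)) (lfm_conv (sneg A) (spos B))).

Fixpoint sconvn A (n : nat) : smeasure R :=
  if n is k.+1 then sconv A (sconvn A k) else sdirac1.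

Lemma sconvn_le A (x r : R) : spos A `[1%R, x]%classic + sneg A `[1%R, x]%classic <= r%:E ->
  forall n, spos (sconvn A n) `[1%R, x]%classic + sneg (sconvn A n) `[1%R, x]%classic
            <= (r ^+ n)%:E.
Proof.
move=> Ar; elim => [|n IH].
  by rewrite expr0 /= diracE /mzero adde0 lee_fin; case: (_ \in _).
rewrite exprS EFinM; apply: (@le_trans _ _ (
  (spos A `[1%R, x]%classic + sneg A `[1%R, x]%classic) *
  (spos (sconvn A n) `[1%R, x]%classic + sneg (sconvn A n) `[1%R, x]%classic))); last first.
  by apply: lee_pmul => //; exact: adde_ge0.
rewrite [sconvn A n.+1]/= [spos (sconv _ _)]/= [sneg (sconv _ _)]/= !lfm_addE.
rewrite ge0_muleDl// !ge0_muleDr//.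
rewrite [X in _ <= _ + X]addeC [leRHS]addeACA.
by apply: leeD; apply: leeD; exact: mconv_le.
Qed.

Definition mexp (p : nat -> lfmeasure R) : set R -> \bar R :=
  mseries (fun n => mscale (n`!%:R^-1)%:nng%R (p n)) 0.

HB.instance Definition _ p := Measure.on (mexp p).

Lemma mexp_fin (p : nat -> lfmeasure R) (x r : R) : (0 <= r)%R ->
  (forall n, p n `[1%R, x]%classic <= (r ^+ n)%:E) ->
  mexp p `[1%R, x]%classic < +oo.
Proof.
move=> r0 pr; apply: (@le_lt_trans _ _ (\sum_(0 <= n <oo) (exp_coeff r n)%:E)).
  apply: lee_nneseries => [n _ _|n _]; first exact: measure_ge0.
  rewrite /exp_coeff/= /mscale mulrC EFinM.
  by rewrite lee_wpmul2l ?lee_fin// pr.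
rewrite (_ : \sum_(0 <= n <oo) _ = (expR r)%:E) ?ltry//.
apply/cvg_lim => //; under eq_fun do rewrite sumEFin.
apply: cvg_EFin; first by near=> n.
exact: is_cvg_series_exp_coeff.
Unshelve. all: by end_near. Qed.

Lemma mexp_supp (p : nat -> lfmeasure R) : mexp p `]-oo, 1%R[%classic = 0.
Proof.
by rewrite /mexp /mseries eseries0// => n _ _; rewrite /= /mscale lfm_supp mule0.
Qed.

Lemma sexp_pos_fin A (x : R) :
  mexp (fun n => spos (sconvn A n)) `[1%R, x]%classic < +oo.
Proof.
have fA : spos A `[1%R, x]%classic + sneg A `[1%R, x]%classic \is a fin_num.
  by rewrite ge0_fin_numE ?adde_ge0// lte_add_pinfty//; exact: lfm_fin.
apply: (@mexp_fin _ _ (fine (spos A `[1%R, x]%classic + sneg A `[1%R, x]%classic))).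
  by rewrite fine_ge0// adde_ge0.
move=> n; apply: le_trans (@sconvn_le A x _ _ n); last by rewrite fineK.
by rewrite leeDl.
Qed.

Lemma sexp_neg_fin A (x : R) :
  mexp (fun n => sneg (sconvn A n)) `[1%R, x]%classic < +oo.
Proof.
have fA : spos A `[1%R, x]%classic + sneg A `[1%R, x]%classic \is a fin_num.
  by rewrite ge0_fin_numE ?adde_ge0// lte_add_pinfty//; exact: lfm_fin.
apply: (@mexp_fin _ _ (fine (spos A `[1%R, x]%classic + sneg A `[1%R, x]%classic))).
  by rewrite fine_ge0// adde_ge0.
move=> n; apply: le_trans (@sconvn_le A x _ _ n); last by rewrite fineK.
by rewrite leeDr.
Qed.

Definition sexp A : smeasure R :=
  SMeasure (LFMeasure (sexp_pos_fin A) (mexp_supp _))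
           (LFMeasure (sexp_neg_fin A) (mexp_supp _)).

Definition piece (n : nat) : set R := `[n%:R, n.+1%:R[%classic.

Lemma measurable_piece n : measurable (piece n).
Proof. exact: measurable_itv. Qed.

Definition lfm_piece (m : lfmeasure R) (n : nat) : set R -> \bar R :=
  mrestr m (measurable_piece n).

HB.instance Definition _ m n := Measure.on (lfm_piece m n).

Lemma lfm_piece_fin m n : fin_num_fun (lfm_piece m n).
Proof.
move=> X mX; rewrite ge0_fin_numE ?measure_ge0// /lfm_piece /mrestr.
apply: le_lt_trans (lfm_ray_fin m n.+1%:R).
apply: le_measure; rewrite ?inE//; first by apply: measurableI => //; exact: measurable_piece.
by move=> y [_]; rewrite /piece /= !in_itv/= => /andP[_ /ltW].
Qed.

HB.instance Definition _ m n :=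
  Measure_isFinite.Build _ _ _ (lfm_piece m n) (lfm_piece_fin m n).

Definition spiece A (n : nat) : {charge set R -> \bar R} :=
  cadd (charge_of_finite_measure (lfm_piece (spos A) n))
       (copp (charge_of_finite_measure (lfm_piece (sneg A) n))).

Definition charge_var (nu : {charge set R -> \bar R}) :
    {measure set R -> \bar R} :=
  charge_variation (projT2 (cid (projT2 (cid (Hahn_decomposition nu))))).

(* The total variation measure |dA|. A charge in the library is finite, so the
   variations of the restrictions of dA to the intervals [n, n + 1[ are summed. *)
Definition mvar A : set R -> \bar R := mseries (fun n => charge_var (spiece A n)) 0.

HB.instance Definition _ A := Measure.on (mvar A).

Lemma spieceE A n (X : set R) : measurable X ->
  spiece A n X = (signed_val A (X `&` piece n))%:E.
Proof.
move=> mX.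
have fin m : (m : lfmeasure R) (X `&` piece n) \is a fin_num.
  exact: (@lfm_piece_fin m n _ mX).
by rewrite /signed_val EFinB !fineK.
Qed.

Lemma charge_var_abs (nu : {charge set R -> \bar R}) (X : set R) :
  measurable X -> `|nu X| <= charge_var nu X.
Proof. exact: abse_charge_variation. Qed.

Lemma charge_variation_le (nu : {charge set R -> \bar R}) (P N : set R)
    (nuPN : hahn_decomposition nu P N) (mu : {measure set R -> \bar R}) :
  (forall X, measurable X -> `|nu X| <= mu X) ->
  forall X, measurable X -> charge_variation nuPN X <= mu X.
Proof.
move=> numu X mX; have [[mP _] [mN _] PNT PN0] := nuPN.
rewrite /charge_variation /= jordan_posE jordan_negE cjordan_posE cjordan_negE.
rewrite /crestr0 mem_set// /crestr.
rewrite -[X in _ <= mu X]setIT -PNT setIUr measureU//; last 3 first.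
- exact: measurableI.
- exact: measurableI.
- by rewrite setIACA setIid PN0 setI0.
apply: leeD.
  by apply: le_trans (numu _ (measurableI _ _ mX mP)); exact: lee_abs.
apply: le_trans (numu _ (measurableI _ _ mX mN)).
by rewrite -abseN; exact: lee_abs.
Qed.

Lemma charge_var_le (nu : {charge set R -> \bar R})
    (mu : {measure set R -> \bar R}) :
  (forall X, measurable X -> `|nu X| <= mu X) ->
  forall X, measurable X -> charge_var nu X <= mu X.
Proof. exact: charge_variation_le. Qed.

Lemma measure_pieces (mu : {measure set R -> \bar R}) (X : set R) :
  measurable X ->
  \sum_(0 <= n <oo) mu (X `&` piece n) = mu (X `&` `[0%R, +oo[).
Proof.
move=> mX.
have -> : X `&` `[0%R, +oo[ = \bigcup_n (X `&` piece n).
  rewrite -setI_bigcupr; congr (_ `&` _); apply/seteqP; split => y /=.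
    rewrite in_itv/= andbT => y0; exists (Num.trunc y) => //.
    by rewrite /piece/= in_itv/=; exact: trunc_itv.
  by move=> [n _]; rewrite /piece/= !in_itv/= andbT => /andP[+ _]; exact: le_trans.
apply/cvg_lim => //; apply: measure_semi_sigma_additive.
- by move=> n; apply: measurableI => //; exact: measurable_piece.
- apply: trivIset_setIl; apply/trivIsetP => i j _ _ ij.
  apply/seteqP; split => // y [].
  rewrite /piece/= !in_itv/= => /andP[iy yi] /andP[jy yj].
  move: ij; rewrite neq_ltn => /orP[ij|ij].
    have h : (i.+1%:R <= j%:R :> R)%R by rewrite ler_nat.
    by have := lt_le_trans yi (le_trans h jy); rewrite ltxx.
  have h : (j.+1%:R <= i%:R :> R)%R by rewrite ler_nat.
  by have := lt_le_trans yj (le_trans h iy); rewrite ltxx.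
- by apply: bigcup_measurable => n _; apply: measurableI => //; exact: measurable_piece.
Qed.

Lemma lfm_pieces (m : lfmeasure R) (X : set R) : measurable X ->
  m X = \sum_(0 <= n <oo) lfm_piece m n X.
Proof.
move=> mX; rewrite [RHS](measure_pieces m mX).
rewrite -[in LHS](setIT X) -(setUv `[0%R, +oo[) setIUr measureU//; last 3 first.
- exact: measurableI.
- by apply: measurableI => //; exact: measurableC.
- by rewrite setIACA setICr setI0.
rewrite [X in _ + X](_ : _ = 0) ?adde0//.
apply/eqP; rewrite eq_le measure_ge0 andbT -(lfm_supp m).
apply: le_measure; rewrite ?inE//.
  by apply: measurableI => //; exact: measurableC.
move=> y [_]/=; rewrite !in_itv/= andbT => /negP; rewrite -ltNge => y0.
exact: lt_trans ltr01.
Qed.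

(* Together with mvar_abs: mvar A is the least measure that bounds |A(X)| for
   every bounded Borel set X. *)
Lemma mvar_le A (mu : {measure set R -> \bar R}) :
  (forall (X : set R) (x : R), measurable X -> X `<=` `]-oo, x] ->
    `|signed_val A X|%:E <= mu X) ->
  forall X, measurable X -> mvar A X <= mu X.
Proof.
move=> Amu X mX; apply: (@le_trans _ _ (mu (X `&` `[0%R, +oo[))); last first.
  apply: le_measure; rewrite ?inE//; first exact: measurableI.
rewrite -measure_pieces//; apply: lee_nneseries => [n _ _|n _].
  exact: measure_ge0.
apply: (@charge_var_le _ (mrestr mu (measurable_piece n))) => // Y mY.
rewrite spieceE// abse_EFin; apply: (Amu _ n.+1%:R).
  by apply: measurableI => //; exact: measurable_piece.
by move=> y [_]; rewrite /piece /= !in_itv/= => /andP[_ /ltW].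
Qed.

Lemma mvar_le_add A (X : set R) : measurable X -> mvar A X <= spos A X + sneg A X.
Proof.
move=> mX; rewrite -lfm_addE; apply: mvar_le => // Y x mY Yx.
have fin m : (m : lfmeasure R) Y \is a fin_num.
  rewrite ge0_fin_numE//; apply: le_lt_trans (lfm_ray_fin m x).
  by apply: le_measure; rewrite ?inE.
rewrite lfm_addE -[spos A Y]fineK ?fin// -[sneg A Y]fineK ?fin//.
rewrite -EFinD lee_fin; apply: le_trans (ler_normB _ _) _.
by rewrite !ger0_norm ?fine_ge0.
Qed.

Lemma mvar_abs A (X : set R) (x : R) : measurable X -> X `<=` `]-oo, x] ->
  `|signed_val A X|%:E <= mvar A X.
Proof.
move=> mX Xx.
have fin m : (m : lfmeasure R) X \is a fin_num.
  rewrite ge0_fin_numE//; apply: le_lt_trans (lfm_ray_fin m x).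
  by apply: le_measure; rewrite ?inE.
have key n : `|lfm_piece (spos A) n X - lfm_piece (sneg A) n X|
    <= charge_var (spiece A n) X by exact: charge_var_abs.
have fp m n : lfm_piece m n X \is a fin_num by exact: lfm_piece_fin.
have le1 : spos A X <= mvar A X + sneg A X.
  rewrite (lfm_pieces _ mX) [X in _ + X](lfm_pieces _ mX) -nneseriesD//.
  apply: lee_nneseries => // n _.
  by rewrite -leeBlDr//; apply: le_trans (key n); exact: lee_abs.
have le2 : sneg A X <= mvar A X + spos A X.
  rewrite (lfm_pieces _ mX) [X in _ + X](lfm_pieces _ mX) -nneseriesD//.
  apply: lee_nneseries => // n _.
  rewrite -leeBlDr//; apply: le_trans (key n).
  by rewrite -abseN fin_num_oppeB// addeC; exact: lee_abs.
have fv : mvar A X \is a fin_num.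
  rewrite ge0_fin_numE; last exact: measure_ge0.
  apply: (le_lt_trans (mvar_le_add _ _)) => //.
  by rewrite lte_add_pinfty// -ge0_fin_numE.
move: le1 le2; rewrite /signed_val -(fineK (fin (spos A))) -(fineK (fin (sneg A))).
rewrite -(fineK fv) -!EFinD !lee_fin /= => le1 le2.
by rewrite ler_norml lerNl opprB !lerBlDr le1 le2.
Qed.

Lemma svar_fin A (x : R) : mvar A `[1%R, x]%classic < +oo.
Proof.
apply: (le_lt_trans (mvar_le_add _ _)) => //.
by rewrite lte_add_pinfty//; exact: lfm_fin.
Qed.

Lemma svar_supp A : mvar A `]-oo, 1%R[%classic = 0.
Proof.
apply/eqP; rewrite eq_le measure_ge0 andbT.
by apply: (le_trans (mvar_le_add _ _)) => //; rewrite !lfm_supp adde0.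
Qed.

Definition svar A : lfmeasure R := LFMeasure (svar_fin A) (svar_supp A).

End smeasure_theory.

(* Main.v *)
(** A positive measure [m] acts on functions by dilations, sending [g] to
    [x |-> \int g (x u) dm(u)]. A signed measure, given as a pair of positive ones,
    acts in the same way on functions of a sign and a point. All series and integrals
    are then nonnegative, so that Tonelli's theorem and the exponential law for
    commuting sigma-additive operators give [exp*(dA + dB) = exp*(dA) * exp*(dB)], and

      [|M_(A+B)(x)| <= \int |M_A (x / u)| d(exp*(|dB|))(u)], where [dM_A := exp*(dA)].

    Adding one measure to both parts of [A] does not change [M_A], hence [E] and [R]
    may be replaced by their Jordan decompositions.

    The measure [R] is a perturbation that preserves [o(x)]: the integral of [1 / u]
    against [exp*(|dR|)] is at most [exp (\int |dR| / u) < oo], and dominated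
    convergence applies.

    For [E], put [F := exp*(|dE|)], [t := 1 + log y] and
    [J(y) := \int_[1,y] (1 + log (y / u))^(-a) dF(u) / u], which bounds
    [|M_(-Pi0-E)(y)| / y] up to a constant factor. As [\int_[1,y] |dE| / u = o(log t)],
    the integral [H(y)] of [1 / u] against [dF] over [[1, y]] is [O(t^d)] for every
    [d > 0]. The identity [log dF = (log |dE|) * dF], together with the splitting of
    the integral against [log |dE|] over [[1, z]] at [z exp (- sqrt (1 + log z))], gives
    [t J(y) = O(t^(1 - a/2) H(y))], hence [J(y) = O(t^(-a/4))]. *)

Require Import Defs.
From HB Require Import structures.
From mathcomp Require Import all_boot all_order all_algebra.
From mathcomp Require Import all_classical all_reals all_analysis.
From mathcomp Require Import measurable_realfun ring lra.

Set Implicit Arguments.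
Unset Strict Implicit.
Unset Printing Implicit Defensive.

Import Order.TTheory GRing.Theory Num.Theory.
Import numFieldNormedType.Exports.

Local Open Scope classical_set_scope.
Local Open Scope ring_scope.

Lemma sum_binS (V : nmodType) (a : nat -> nat -> V) n :
  \sum_(i < n.+2) a i (n.+1 - i)%N *+ 'C(n.+1, i) =
   \sum_(i < n.+1) (a i.+1 (n - i)%N + a i (n.+1 - i)%N) *+ 'C(n, i).
Proof.
rewrite big_ord_recl bin0.
under eq_bigr do rewrite lift0 subSS binS mulrnDr.
under [RHS]eq_bigr do rewrite mulrnDl.
rewrite !big_split/= addrA [LHS]addrC; congr (_ + _).
rewrite big_ord_recr/= bin_small// mulr0n addr0 [RHS]big_ord_recl bin0.
by congr (_ + _); apply: eq_bigr => i _; rewrite lift0 subSS.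
Qed.

Section extended_reals.
Local Open Scope ereal_scope.
Context {R : realType}.

Lemma nneseries_diagonal (f : nat -> nat -> \bar R) : (forall i j, 0 <= f i j) ->
  \sum_(0 <= n <oo) \sum_(i < n.+1) f i (n - i)%N =
  \sum_(0 <= i <oo) \sum_(0 <= j <oo) f i j.
Proof.
move=> f0; pose a n i := if (i <= n)%N then f i (n - i)%N else 0.
have a0 n i : 0 <= a n i by rewrite /a; case: ifP.
transitivity (\sum_(0 <= n <oo) \sum_(0 <= i <oo) a n i).
  apply: eq_eseriesr => n _.
  rewrite (@nneseries_split _ _ 0%N n.+1)// add0n.
  rewrite [X in _ + X]eseries0 ?adde0; last first.
    by move=> i ni _; rewrite /a leqNgt ni.
  by rewrite big_mkord; apply: eq_bigr => i _; rewrite /a -ltnS ltn_ord.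
rewrite nneseries_interchange//; apply: eq_eseriesr => i _.
rewrite (@nneseries_split _ _ 0%N i)// add0n big1_seq ?add0e; last first.
  by move=> n /andP[_]; rewrite mem_index_iota/= => ni; rewrite /a leqNgt ni.
by rewrite -nneseries_addn//; apply: eq_eseriesr => j _; rewrite /a leq_addl addnK.
Qed.

Lemma nneseries_exp_coeff (r : R) : \sum_(0 <= n <oo) (exp_coeff r n)%:E = (expR r)%:E.
Proof.
apply/cvg_lim => //; under eq_fun do rewrite sumEFin.
apply: cvg_EFin; first by near=> n.
exact: is_cvg_series_exp_coeff.
Unshelve. all: by end_near. Qed.

Lemma normr_fineB_le (a b c : \bar R) : a \is a fin_num -> b \is a fin_num ->
  a <= b + c -> b <= a + c -> `|fine a - fine b|%:E <= c.
Proof.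
case: a b c => [a| |] [b| |] [c| |]//= _ _; rewrite ?leey//.
by rewrite !lee_fin => ab ba; rewrite ler_norml; apply/andP; split; lra.
Qed.

End extended_reals.

Section real_functions.
Context {R : realType}.
Implicit Types x u : R.

Lemma ge1_invr_ge0 u : 1 <= u -> 0 <= u^-1.
Proof. by move=> u1; rewrite invr_ge0 (le_trans ler01). Qed.

Lemma measurable_invr : measurable_fun [set: R] (fun u : R => u^-1)%R.
Proof.
rewrite (_ : (fun u => _) = fun u => (u * (u ^+ 2) `^ (-1))%R).
  apply: measurable_funM => //; apply: (measurableT_comp (measurable_powR _)).
  exact: exprn_measurable.
apply/funext => u; rewrite powR_inv1 ?sqr_ge0// expr2.
by have [->|u0] := eqVneq u 0%R; rewrite ?mul0r ?invr0// invfM mulrA divff// mul1r.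
Qed.

Lemma measurable_divr x : measurable_fun [set: R] (fun u : R => x / u)%R.
Proof. by apply: measurable_funM => //; exact: measurable_invr. Qed.

Lemma measurable_ln_div : measurable_fun [set: R] (fun u : R => ln u / u).
Proof. by apply: measurable_funM; [exact: measurable_ln|exact: measurable_invr]. Qed.

Lemma ln_div_ge0 u : 1 <= u -> 0 <= ln u / u.
Proof. by move=> u1; rewrite mulr_ge0 ?ln_ge0 ?ge1_invr_ge0. Qed.

Lemma expR_ge1 x : 0 <= x -> 1 <= expR x.
Proof. by move=> x0; rewrite -[leLHS]expR0 ler_expR. Qed.

Lemma inv_le_lnB x : 0 < x -> (x + 1)^-1 <= ln (x + 1) - ln x.
Proof.
move=> x0; have x10 : 0 < x + 1 by rewrite addr_gt0.
have opp_invE : - (x + 1)^-1 = x / (x + 1) - 1 by field; rewrite gt_eqF.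
rewrite -lerN2 opprB -ln_div ?posrE// opp_invE.
rewrite -[X in ln X](subrK 1) [X in ln X]addrC; apply: le_ln1Dx.
by rewrite ltrBrDr addNr divr_gt0.
Qed.

End real_functions.

Section nonneg_measurable_functions.
Local Open Scope ereal_scope.
Context {R : realType} {d : measure_display} {X : measurableType d}.
Implicit Types g h : X -> \bar R.

Definition nnmfun g := measurable_fun [set: X] g /\ forall x, 0 <= g x.

Lemma nnmfun_cst (k : \bar R) : 0 <= k -> nnmfun (cst k).
Proof. by move=> k0; split => //; exact: measurable_cst. Qed.

Lemma nnmfunD g h : nnmfun g -> nnmfun h -> nnmfun (fun x => g x + h x).
Proof.
move=> [mg g0] [mh h0]; split; first exact: emeasurable_funD.
by move=> x; exact: adde_ge0.
Qed.

Lemma nnmfunM g h : nnmfun g -> nnmfun h -> nnmfun (fun x => g x * h x).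
Proof.
move=> [mg g0] [mh h0]; split; first exact: emeasurable_funM.
by move=> x; exact: mule_ge0.
Qed.

Lemma nnmfunZ (k : \bar R) g : 0 <= k -> nnmfun g -> nnmfun (fun x => k * g x).
Proof. by move=> /nnmfun_cst; exact: nnmfunM. Qed.

Lemma nnmfun_nneseries (h : nat -> X -> \bar R) : (forall n, nnmfun (h n)) ->
  nnmfun (fun x => \sum_(0 <= n <oo) h n x).
Proof.
move=> nh; split.
  by apply: ge0_emeasurable_sum => [n x _ _|n _]; case: (nh n).
by move=> x; apply: nneseries_ge0 => n _ _; case: (nh n).
Qed.

Lemma nnmfun_EFin (f : X -> R) : measurable_fun [set: X] f ->
  (forall x, 0 <= f x)%R -> nnmfun (fun x => (f x)%:E).
Proof.
by move=> mf f0; split; [exact/measurable_EFinP|move=> x; rewrite lee_fin].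
Qed.

End nonneg_measurable_functions.

Lemma nnmfun_comp (R : realType) d d' (X : measurableType d)
    (Y : measurableType d') (g : Y -> \bar R) (f : X -> Y) :
  nnmfun g -> measurable_fun [set: X] f -> nnmfun (g \o f).
Proof. by move=> [mg g0] mf; split=> [|x]; [exact: measurableT_comp|exact: g0]. Qed.

Section sigma_linear_operators.
Local Open Scope ereal_scope.
Context {R : realType} {d : measure_display} {X : measurableType d}.
Implicit Types (g h : X -> \bar R) (S T : (X -> \bar R) -> X -> \bar R).

Record sigma_linear S : Prop := SigmaLinear {
  sigma_linear_nnmfun : forall g, nnmfun g -> nnmfun (S g) ;
  sigma_linearD : forall g h, nnmfun g -> nnmfun h ->
    S (fun x => g x + h x) = fun x => S g x + S h x ;
  sigma_linearZ : forall k g, 0 <= k -> nnmfun g ->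
    S (fun x => k * g x) = fun x => k * S g x ;
  sigma_linear_nneseries : forall h : nat -> X -> \bar R,
    (forall n, nnmfun (h n)) ->
    S (fun x => \sum_(0 <= n <oo) h n x) = fun x => \sum_(0 <= n <oo) S (h n) x }.

Lemma sigma_linear_iter S n : sigma_linear S -> sigma_linear (iter n S).
Proof.
move=> lS; elim: n => [|n lSn]; first exact: SigmaLinear.
have nSn := sigma_linear_nnmfun lSn.
split=> /= [g ng|g h ng nh|k g k0 ng|h nh].
- by apply: (sigma_linear_nnmfun lS); exact: nSn.
- by rewrite (sigma_linearD lSn)// (sigma_linearD lS)//; exact: nSn.
- by rewrite (sigma_linearZ lSn)// (sigma_linearZ lS)//; exact: nSn.
- rewrite (sigma_linear_nneseries lSn)// (sigma_linear_nneseries lS)// => m.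
  exact: nSn.
Qed.

Definition add_op S T g (x : X) : \bar R := S g x + T g x.

Lemma sigma_linear_add S T : sigma_linear S -> sigma_linear T ->
  sigma_linear (add_op S T).
Proof.
move=> lS lT; have nS := sigma_linear_nnmfun lS; have nT := sigma_linear_nnmfun lT.
split=> [g ng|g h ng nh|k g k0 ng|h nh].
- by apply: nnmfunD; [exact: nS|exact: nT].
- by apply/funext => x; rewrite /add_op !sigma_linearD// addeACA.
- apply/funext => x; rewrite /add_op !sigma_linearZ// ge0_muleDr//.
    by case: (nS _ ng).
  by case: (nT _ ng).
- apply/funext => x; rewrite /add_op !sigma_linear_nneseries// nneseriesD// => n _ _.
    by case: (nS _ (nh n)).
  by case: (nT _ (nh n)).
Qed.

Lemma nnmfun_iter S n g : sigma_linear S -> nnmfun g -> nnmfun (iter n S g).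
Proof. by move=> lS; exact/sigma_linear_nnmfun/sigma_linear_iter. Qed.

Definition commuting_op S T := forall g, nnmfun g -> S (T g) = T (S g).

Lemma commuting_op_iter S T n : sigma_linear S -> commuting_op S T ->
  commuting_op (iter n S) T.
Proof.
by move=> lS ST g ng; elim: n => // n IH; rewrite !iterS IH ST//; exact: nnmfun_iter.
Qed.

Definition inv_fact (n : nat) : \bar R := (n`!%:R^-1)%:E.

Lemma inv_fact_ge0 n : 0 <= inv_fact n.
Proof. by rewrite lee_fin. Qed.

Lemma inv_fact0 : inv_fact 0 = 1.
Proof. by rewrite /inv_fact fact0 invr1. Qed.

Lemma inv_factS n : inv_fact n.+1 * n.+1%:R%:E = inv_fact n.
Proof. by rewrite -EFinM factS natrM invfM mulrAC mulVf ?mul1r. Qed.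

Lemma inv_factM_bin n i : (i <= n)%N ->
  inv_fact n * 'C(n, i)%:R%:E = inv_fact i * inv_fact (n - i).
Proof.
move=> le_in; rewrite /inv_fact -!EFinM -(bin_fact le_in) !natrM.
have bin_neq0 : ('C(n, i)%:R != 0 :> R)%R by rewrite pnatr_eq0 -lt0n bin_gt0.
have fact_neq0 k : (k`!%:R != 0 :> R)%R by rewrite pnatr_eq0 -lt0n fact_gt0.
by congr EFin; field; rewrite bin_neq0 !fact_neq0.
Qed.

Definition expop S g (x : X) : \bar R :=
  \sum_(0 <= n <oo) inv_fact n * iter n S g x.

Lemma expop_term_ge0 S g n x : sigma_linear S -> nnmfun g ->
  0 <= inv_fact n * iter n S g x.
Proof.
by move=> lS ng; rewrite mule_ge0 ?inv_fact_ge0//; case: (nnmfun_iter n lS ng).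
Qed.

Lemma expop_recl S g x : sigma_linear S -> nnmfun g ->
  expop S g x = g x + \sum_(0 <= n <oo) inv_fact n.+1 * iter n.+1 S g x.
Proof.
move=> lS ng; rewrite /expop nneseries_recl//; last by move=> n _; exact: expop_term_ge0.
rewrite inv_fact0 mul1e -nneseries_addn//; last by move=> n; exact: expop_term_ge0.
by under eq_eseriesr do rewrite addn1.
Qed.

Lemma eq_expop S T g : sigma_linear S -> (forall h, nnmfun h -> S h = T h) ->
  nnmfun g -> expop S g = expop T g.
Proof.
move=> lS ST ng; apply/funext => x; apply: eq_eseriesr => n _; congr (_ * _ x).
by elim: n => // n IH; rewrite !iterS -IH ST//; exact: nnmfun_iter.
Qed.

Lemma iter_add_op S T n g x : sigma_linear S -> sigma_linear T ->
  commuting_op S T -> nnmfun g ->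
  iter n (add_op S T) g x =
  (\sum_(i < n.+1) iter i S (iter (n - i) T g) x *+ 'C(n, i))%R.
Proof.
move=> lS lT ST; have nS := sigma_linear_nnmfun lS.
have nT := sigma_linear_nnmfun lT.
elim: n g => [|n IH] g ng; first by rewrite big_ord1 bin0.
rewrite (sum_binS (fun i j => iter i S (iter j T g) x)) iterSr.
rewrite (sigma_linearD (sigma_linear_iter n (sigma_linear_add lS lT)))//; last 2 first.
- exact: nS.
- exact: nT.
rewrite /add_op !IH; [|exact: nT|exact: nS].
rewrite -big_split; apply: eq_bigr => i _ /=; rewrite mulrnDl; congr (_ *+ _ + _ *+ _)%R.
  by rewrite (commuting_op_iter (n - i) lT (fun h nh => esym (ST h nh)))// -iterS iterSr.
by rewrite -iterSr subSn// -ltnS.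
Qed.

Lemma nnmfun_expop S g : sigma_linear S -> nnmfun g -> nnmfun (expop S g).
Proof.
move=> lS ng; apply: nnmfun_nneseries => n.
by apply: nnmfunZ; [exact: inv_fact_ge0|exact: nnmfun_iter].
Qed.

Lemma expop_add S T g : sigma_linear S -> sigma_linear T -> commuting_op S T ->
  nnmfun g -> expop (add_op S T) g = expop S (expop T g).
Proof.
move=> lS lT ST ng; apply/funext => x.
pose f i j := inv_fact i * (inv_fact j * iter i S (iter j T g) x).
have nST i j : nnmfun (iter i S (iter j T g)) by do 2 apply: nnmfun_iter => //.
have f0 i j : 0 <= f i j.
  by rewrite !mule_ge0 ?inv_fact_ge0//; case: (nST i j).
transitivity (\sum_(0 <= n <oo) \sum_(i < n.+1) f i (n - i)%N).
  apply: eq_eseriesr => n _; rewrite iter_add_op// ge0_sume_distrr.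
    apply: eq_bigr => i _; rewrite /f muleA -inv_factM_bin; last by rewrite -ltnS.
    by rewrite -muleA mule_natl.
  by move=> i _; rewrite -[(_ *+ _)%R]mule_natl mule_ge0//; case: (nST i (n - i)%N).
rewrite nneseries_diagonal//; apply: eq_eseriesr => i _.
have nT j : nnmfun (fun y => inv_fact j * iter j T g y).
  by apply: nnmfunZ; [exact: inv_fact_ge0|exact: nnmfun_iter].
rewrite /f nneseriesZl//; last first.
  by move=> j _; rewrite mule_ge0 ?inv_fact_ge0//; case: (nST i j).
congr (_ * _); rewrite (sigma_linear_nneseries (sigma_linear_iter i lS))//.
apply: eq_eseriesr => j _; rewrite (sigma_linearZ (sigma_linear_iter i lS))//.
- exact: inv_fact_ge0.
- exact: nnmfun_iter.
Qed.

End sigma_linear_operators.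

Section lfmeasure_integral.
Local Open Scope ereal_scope.
Context {R : realType}.
Implicit Types (m : lfmeasure R) (g h : R -> \bar R).

Lemma lfm_integralE m g : nnmfun g ->
  \int[m]_u g u = \int[m]_(u in `[1%R, +oo[) g u.
Proof.
move=> [mg g0].
rewrite (ge0_negligible_integral (measurable_itv `]-oo, 1%R[)
  measurableT mg _ (lfm_supp m))//.
by rewrite setTD setCitvl.
Qed.

Lemma le_lfm_integral m g h : nnmfun g -> nnmfun h ->
  (forall u, (1 <= u)%R -> g u <= h u) -> \int[m]_u g u <= \int[m]_u h u.
Proof.
move=> ng nh gh; rewrite !lfm_integralE//.
have [[mg g0] [mh h0]] := (ng, nh).
apply: ge0_le_integral => //; [exact: measurable_funTS..|].
by move=> u; rewrite /= in_itv/= andbT; exact: gh.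
Qed.

Lemma lfm_integralZl m (k : \bar R) g : 0 <= k -> nnmfun g ->
  \int[m]_u (k * g u) = k * \int[m]_u g u.
Proof. by move=> k0 [mg g0]; rewrite ge0_integralZl. Qed.

Lemma lfm_integralD m g h : nnmfun g -> nnmfun h ->
  \int[m]_u (g u + h u) = \int[m]_u g u + \int[m]_u h u.
Proof. by move=> [mg g0] [mh h0]; rewrite ge0_integralD. Qed.

End lfmeasure_integral.

Section dilation_operators.
Local Open Scope ereal_scope.
Context {R : realType}.
Implicit Types (m : lfmeasure R) (g h : R -> \bar R) (w : R -> R).

Definition dil m g (x : R) : \bar R := \int[m]_u g (x * u)%R.

Definition wdil m w g (x : R) : \bar R := \int[m]_u ((w u)%:E * g (x * u)%R).

Lemma wdil_cst1 m : wdil m (cst 1%R) = dil m.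
Proof.
apply/funext => g; apply/funext => x.
by apply: eq_integral => u _; rewrite mul1e.
Qed.

Lemma dil1 m g : dil m g 1 = \int[m]_u g u.
Proof. by apply: eq_integral => u _; rewrite mul1r. Qed.

Lemma nnmfun_mulr g (x : R) : nnmfun g -> nnmfun (fun u => g (x * u)%R).
Proof. by move=> ng; apply: (nnmfun_comp (f := *%R x) ng). Qed.

Lemma nnmfun_mulRR g : nnmfun g -> nnmfun (fun z : R * R => g (z.1 * z.2)%R).
Proof. by move=> ng; exact: (nnmfun_comp ng measurable_mulRR). Qed.

Lemma sigma_linear_wdil m w : nnmfun (fun u => (w u)%:E) -> sigma_linear (wdil m w).
Proof.
move=> nw; split.
- move=> g ng; split; last first.
    by move=> x; apply: integral_ge0 => u _; case: (nnmfunM nw (nnmfun_mulr x ng)).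
  have [mf f0] : nnmfun (fun z : R * R => (w z.2)%:E * g (z.1 * z.2)%R).
    apply: nnmfunM; last exact: nnmfun_mulRR.
    exact: (nnmfun_comp nw measurable_snd).
  exact: (measurable_fun_fubini_tonelli_F (m2 := lfm_sf m) _ mf f0).
- move=> g h ng nh; apply/funext => x.
  rewrite /wdil -lfm_integralD; last 2 first.
  + exact: nnmfunM nw (nnmfun_mulr x ng).
  + exact: nnmfunM nw (nnmfun_mulr x nh).
  by apply: eq_integral => u _; rewrite ge0_muleDr; [|case: ng|case: nh].
- move=> k g k0 ng; apply/funext => x.
  rewrite /wdil -lfm_integralZl//; last exact: nnmfunM nw (nnmfun_mulr x ng).
  by apply: eq_integral => u _; rewrite muleCA.
- move=> h nh; apply/funext => x.
  rewrite /wdil -integral_nneseries//; last 2 first.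
  + by move=> n; case: (nnmfunM nw (nnmfun_mulr x (nh n))).
  + by move=> n u _; case: (nnmfunM nw (nnmfun_mulr x (nh n))).
  by apply: eq_integral => u _; rewrite nneseriesZl// => n _; case: (nh n).
Qed.

Lemma wdilC m1 w1 m2 w2 : nnmfun (fun u => (w1 u)%:E) -> nnmfun (fun u => (w2 u)%:E) ->
  commuting_op (wdil m1 w1) (wdil m2 w2).
Proof.
move=> nw1 nw2 g ng; apply/funext => x; have nxg := nnmfun_mulr x ng.
pose f (z : R * R) := (w1 z.1)%:E * ((w2 z.2)%:E * g (x * (z.1 * z.2))%R).
have [mf f0] : nnmfun f.
  apply: nnmfunM; first exact: (nnmfun_comp nw1 measurable_fst).
  apply: nnmfunM; first exact: (nnmfun_comp nw2 measurable_snd).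
  exact: (nnmfun_mulRR nxg).
transitivity (\int[lfm_sf m1]_u \int[lfm_sf m2]_v f (u, v)).
  have nf2 u := nnmfunM nw2 (nnmfun_mulr (x * u)%R ng).
  apply: eq_integral => u _; rewrite -lfm_integralZl//; last by case: nw1.
  by apply: eq_integral => v _; rewrite /f/= mulrA.
rewrite (fubini_tonelli f)//.
have nf1 v := nnmfunM nw1 (nnmfun_mulr (x * v)%R ng).
apply: eq_integral => v _; rewrite -lfm_integralZl//; last by case: nw2.
by apply: eq_integral => u _; rewrite /f/= muleCA mulrAC mulrA.
Qed.

Lemma sigma_linear_dil m : sigma_linear (dil m).
Proof. by rewrite -wdil_cst1; exact/sigma_linear_wdil/(@nnmfun_cst _ _ _ 1). Qed.

Lemma dilC m1 m2 : commuting_op (dil m1) (dil m2).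
Proof. by rewrite -!wdil_cst1; apply: wdilC; exact: (@nnmfun_cst _ _ _ 1). Qed.

Lemma nnmfun_dil m g : nnmfun g -> nnmfun (dil m g).
Proof. exact/sigma_linear_nnmfun/sigma_linear_dil. Qed.

Lemma dilZ m (k : \bar R) g : 0 <= k -> nnmfun g ->
  dil m (fun y => k * g y) = fun y => k * dil m g y.
Proof. exact/sigma_linearZ/sigma_linear_dil. Qed.

Lemma dilD m g h : nnmfun g -> nnmfun h ->
  dil m (fun y => g y + h y) = fun y => dil m g y + dil m h y.
Proof. exact/sigma_linearD/sigma_linear_dil. Qed.

Lemma dil_add m1 m2 g x : nnmfun g ->
  dil (lfm_add m1 m2) g x = dil m1 g x + dil m2 g x.
Proof. by move=> /(nnmfun_mulr x)[mg g0]; rewrite [LHS]ge0_integral_measure_add. Qed.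

Lemma dil_conv m1 m2 g : nnmfun g -> dil (lfm_conv m1 m2) g = dil m1 (dil m2 g).
Proof.
move=> ng; apply/funext => x; have [mg g0] := nnmfun_mulr x ng.
rewrite /dil [LHS](ge0_integral_pushforward measurable_mulRR)// preimage_setT.
rewrite (fubini_tonelli1 (m1 := lfm_sf m1))/=; last 2 first.
- exact: (measurableT_comp mg measurable_mulRR).
- by move=> z; apply: g0.
apply: eq_integral => u _; apply: eq_integral => v _.
by rewrite /= /mulRR mulrA.
Qed.

Lemma dil_dirac1 g : nnmfun g -> dil lfm_dirac1 g = g.
Proof.
move=> ng; apply/funext => x; have [mg g0] := nnmfun_mulr x ng.
by rewrite /dil [LHS]integral_dirac// diracT mul1e mulr1.
Qed.

Lemma dil_lfm0 g x : dil lfm0 g x = 0.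
Proof. exact: integral_measure_zero. Qed.

Lemma dil_mexp (p : nat -> lfmeasure R) fin supp g x : nnmfun g ->
  dil (@LFMeasure R (mexp p) fin supp) g x =
  \sum_(0 <= n <oo) inv_fact n * dil (p n) g x.
Proof.
move=> /(nnmfun_mulr x)[mg g0].
rewrite /dil [LHS]ge0_integral_measure_series//.
by apply: eq_eseriesr => n _; rewrite [LHS]ge0_integral_mscale.
Qed.

Lemma eq_dil m1 m2 : (forall X, measurable X -> m1 X = m2 X) -> dil m1 = dil m2.
Proof.
move=> m12; apply/funext => g; apply/funext => x.
by apply: eq_measure_integral => X mX _; exact: m12.
Qed.

Lemma le_dil m g h x : nnmfun g -> nnmfun h -> (1 <= x)%R ->
  (forall y, (1 <= y)%R -> g y <= h y) -> dil m g x <= dil m h x.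
Proof.
move=> ng nh x1 gh; apply: le_lfm_integral; [exact: nnmfun_mulr..|].
by move=> u u1; apply: gh; exact: mulr_ege1.
Qed.

End dilation_operators.

Section signed_dilation.
Local Open Scope ereal_scope.
Context {R : realType}.
Implicit Types (m : lfmeasure R) (A B : smeasure R) (g : bool * R -> \bar R).

(* A signed measure is encoded as a positive measure on {+, -} x [1, oo[, acting by
   dilations; [true] is the positive sign. *)
Definition sdil A g (z : bool * R) : \bar R :=
  dil (spos A) (fun y => g (z.1, y)) z.2 + dil (sneg A) (fun y => g (~~ z.1, y)) z.2.

Lemma nnmfun_pair g s : nnmfun g -> nnmfun (fun y => g (s, y)).
Proof. by move=> ng; exact: (nnmfun_comp ng (pair1_measurable s)). Qed.

Lemma nnmfun_dil_pair m g : nnmfun g ->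
  nnmfun (fun z : bool * R => dil m (fun y => g (z.1, y)) z.2).
Proof.
move=> ng; split; last by move=> z; case: (nnmfun_dil m (nnmfun_pair z.1 ng)).
have [mf f0] : nnmfun (fun t : (bool * R) * R => g (t.1.1, t.1.2 * t.2)%R).
  apply: (nnmfun_comp (f := fun t : (bool * R) * R => (t.1.1, t.1.2 * t.2)%R) ng).
  apply: measurable_fun_pair.
    exact: (measurableT_comp measurable_fst measurable_fst).
  apply: measurable_funM; last exact: measurable_snd.
  exact: (measurableT_comp measurable_snd measurable_fst).
exact: (measurable_fun_fubini_tonelli_F (m2 := lfm_sf m) _ mf f0).
Qed.

Lemma sigma_linear_sdil A : sigma_linear (sdil A).
Proof.
split.
- move=> g ng; apply: nnmfunD; first exact: nnmfun_dil_pair.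
  apply: (nnmfun_comp (f := fun z : bool * R => (~~ z.1, z.2))
    (nnmfun_dil_pair (sneg A) ng)).
  apply: measurable_fun_pair; last exact: measurable_snd.
  exact: measurable_neg measurable_fst.
- move=> g h ng nh; apply/funext => -[s x]; rewrite /sdil/=.
  by rewrite !(dilD _ (nnmfun_pair _ ng) (nnmfun_pair _ nh)) addeACA.
- move=> k g k0 ng; apply/funext => -[s x]; rewrite /sdil/=.
  have pos m t y : 0 <= dil m (fun u => g (t, u)) y.
    by case: (nnmfun_dil m (nnmfun_pair t ng)).
  by rewrite !(dilZ _ k0 (nnmfun_pair _ ng)) [RHS]ge0_muleDr.
- move=> h nh; apply/funext => -[s x]; rewrite /sdil/=.
  have nhs t n := nnmfun_pair t (nh n).
  rewrite !(sigma_linear_nneseries (sigma_linear_dil _) (nhs _)) -nneseriesD// => n _ _.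
    by case: (nnmfun_dil (spos A) (nhs s n)).
  by case: (nnmfun_dil (sneg A) (nhs (~~ s) n)).
Qed.

Lemma nnmfun_sdil A g : nnmfun g -> nnmfun (sdil A g).
Proof. exact/sigma_linear_nnmfun/sigma_linear_sdil. Qed.

Lemma sdil_dil A B g s x : nnmfun g -> sdil A (sdil B g) (s, x) =
  dil (spos A) (dil (spos B) (fun y => g (s, y))) x +
  dil (spos A) (dil (sneg B) (fun y => g (~~ s, y))) x +
  (dil (sneg A) (dil (spos B) (fun y => g (~~ s, y))) x +
   dil (sneg A) (dil (sneg B) (fun y => g (s, y))) x).
Proof.
move=> ng; have nd m t := nnmfun_dil m (nnmfun_pair t ng).
by rewrite /sdil/= negbK !(dilD _ (nd _ _) (nd _ _)).
Qed.

Lemma sdilC A B : commuting_op (sdil A) (sdil B).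
Proof.
move=> g ng; apply/funext => -[s x]; rewrite !sdil_dil//.
have nd t := nnmfun_pair t ng.
rewrite (dilC (spos A) (spos B) (nd s)) (dilC (spos A) (sneg B) (nd (~~ s))).
rewrite (dilC (sneg A) (spos B) (nd (~~ s))) (dilC (sneg A) (sneg B) (nd s)).
by rewrite [LHS]addeACA.
Qed.

Lemma sdil_add A B g : nnmfun g ->
  sdil (sadd A B) g = add_op (sdil A) (sdil B) g.
Proof.
move=> ng; apply/funext => -[s x]; rewrite /add_op /sdil/=.
rewrite !dil_add; [|exact: nnmfun_pair..].
by rewrite addeACA.
Qed.

Lemma sdil_conv A B g : nnmfun g -> sdil (sconv A B) g = sdil A (sdil B g).
Proof.
move=> ng; apply/funext => -[s x]; rewrite sdil_dil// /sdil/=.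
have nd t := nnmfun_pair t ng.
rewrite 2!(dil_add _ _ _ (nd _)) 4!(dil_conv _ _ (nd _)) [LHS]addeACA.
by congr (_ + _); exact: addeC.
Qed.

Lemma sdil_dirac1 g : nnmfun g -> sdil sdirac1 g = g.
Proof.
move=> ng; apply/funext => -[s x]; rewrite /sdil/= dil_lfm0 adde0.
by rewrite dil_dirac1//; exact: nnmfun_pair.
Qed.

Lemma sdil_sconvn A g n : nnmfun g -> sdil (sconvn A n) g = iter n (sdil A) g.
Proof.
move=> ng; elim: n => [|n IH]; first exact: sdil_dirac1.
by rewrite [sconvn _ _]/= sdil_conv// IH.
Qed.

Lemma sdil_sexp A g : nnmfun g -> sdil (sexp A) g = expop (sdil A) g.
Proof.
move=> ng; apply/funext => -[s x]; have nd t := nnmfun_pair t ng.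
have pos m t y : 0 <= dil m (fun u => g (t, u)) y by case: (nnmfun_dil m (nd t)).
rewrite {1}/sdil/= !dil_mexp// -nneseriesD; last 2 first.
- by move=> n _ _; rewrite mule_ge0 ?inv_fact_ge0.
- by move=> n _ _; rewrite mule_ge0 ?inv_fact_ge0.
by apply: eq_eseriesr => n _; rewrite -sdil_sconvn// [RHS]ge0_muleDr.
Qed.

Lemma sdil_sexp_add A B g : nnmfun g ->
  sdil (sexp (sadd A B)) g = sdil (sexp A) (sdil (sexp B) g).
Proof.
move=> ng; have lA := sigma_linear_sdil A; have lB := sigma_linear_sdil B.
rewrite !sdil_sexp//; last exact: nnmfun_expop.
rewrite -expop_add//; last exact: sdilC.
by apply: eq_expop => //; [exact: sigma_linear_sdil|exact: sdil_add].
Qed.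

Lemma eq_sdil A B : (forall X, measurable X -> spos A X = spos B X) ->
  (forall X, measurable X -> sneg A X = sneg B X) -> sdil A = sdil B.
Proof.
move=> /eq_dil posE /eq_dil negE; apply/funext => g; apply/funext => z.
by rewrite /sdil posE negE.
Qed.

End signed_dilation.

Section primitive_of_exponential.
Local Open Scope ereal_scope.
Context {R : realType}.
Implicit Types (m : lfmeasure R) (A B : smeasure R) (g : bool * R -> \bar R).
Implicit Types (h : R -> \bar R) (s : bool) (x y : R).

Definition spart A s : lfmeasure R := if s then spos A else sneg A.

Definition ray x (t : bool * R) : \bar R :=
  if t.1 then (\1_(`]-oo, x]) t.2)%:E else 0.

Lemma nnmfun_ray x : nnmfun (ray x).
Proof.
split; last by move=> [[] y]; rewrite /ray/= ?lee_fin.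
apply: measurable_fun_ifT => //.
apply/measurable_EFinP.
exact: (measurableT_comp (measurable_indic (measurable_itv `]-oo, x])) measurable_snd).
Qed.

Lemma lfm_fin_num m x : m `[1%R, x]%classic \is a fin_num.
Proof. by rewrite ge0_fin_numE// lfm_fin. Qed.

Lemma dil_ray m x y : (0 < y)%R ->
  dil m (fun u => ray x (true, u)) y = m `[1%R, (x / y)%R]%classic.
Proof.
move=> y0; have nyr := nnmfun_mulr y (nnmfun_pair true (nnmfun_ray x)).
rewrite [LHS]lfm_integralE//.
transitivity (\int[m]_(u in `[1%R, +oo[) (\1_(`]-oo, (x / y)%R]) u)%:E).
  apply: eq_integral => u _; rewrite /ray/= !indicE; congr ((nat_of_bool _)%:R)%:E.
  by rewrite !mem_setE !in_itv/= ler_pdivlMr// mulrC.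
rewrite integral_indic//; congr (m _); apply/seteqP; split=> u /=; rewrite !in_itv/=.
  by rewrite andbT => -[-> ->].
by move=> /andP[-> ->].
Qed.

Lemma sdil_ray A x s y : (0 < y)%R ->
  sdil A (ray x) (s, y) = spart A s `[1%R, (x / y)%R]%classic.
Proof.
have dil_ray0 m : dil m (fun u => ray x (false, u)) y = 0 by exact: integral0.
by move=> y0; case: s; rewrite /sdil/= dil_ray// dil_ray0 ?adde0 ?add0e.
Qed.

Lemma primitiveE A x : primitive A x =
  (fine (sdil A (ray x) (true, 1)) - fine (sdil A (ray x) (false, 1)))%R.
Proof. by rewrite !sdil_ray// divr1. Qed.

Lemma sdil_ray_fin_num A x s y : (0 < y)%R -> sdil A (ray x) (s, y) \is a fin_num.
Proof. by move=> y0; rewrite sdil_ray// lfm_fin_num. Qed.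

(* It bounds |dA|, with equality only if (spos A, sneg A) is the Jordan decomposition. *)
Definition sabs A : lfmeasure R := lfm_add (spos A) (sneg A).

Lemma nnmfun_even h : nnmfun h -> nnmfun (fun t : bool * R => h t.2).
Proof. by move=> nh; exact: nnmfun_comp nh measurable_snd. Qed.

Lemma sdil_even A h : nnmfun h ->
  sdil A (fun t => h t.2) = fun t => dil (sabs A) h t.2.
Proof. by move=> nh; apply/funext => -[s x]; rewrite /sdil/= dil_add. Qed.

Lemma dil_sabs_sexp A h : nnmfun h ->
  dil (sabs (sexp A)) h = expop (dil (sabs A)) h.
Proof.
move=> nh; have nhs := nnmfun_even nh.
apply/funext => x; transitivity (sdil (sexp A) (fun t => h t.2) (true, x)).
  by rewrite sdil_even.
rewrite sdil_sexp//; apply: eq_eseriesr => n _; congr (_ * _).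
suff -> : iter n (sdil A) (fun t => h t.2) = fun t => iter n (dil (sabs A)) h t.2 by [].
elim: n => // n IH; rewrite !iterS IH sdil_even//.
by apply: nnmfun_iter => //; exact: sigma_linear_dil.
Qed.

Lemma expop_sdil_diag m g : nnmfun g -> exists2 h, nnmfun h &
  expop (sdil (SMeasure m m)) g = fun t => g t + h t.2.
Proof.
set C := SMeasure m m => ng; have lC := sigma_linear_sdil C.
pose f t := \sum_(0 <= n <oo) inv_fact n.+1 * iter n.+1 (sdil C) g t.
have nf : nnmfun f.
  apply: nnmfun_nneseries => n; apply: nnmfunZ; first exact: inv_fact_ge0.
  exact: nnmfun_iter.
have f_even s y : f (s, y) = f (true, y).
  case: s; first by [].
  apply: eq_eseriesr => n _; congr (_ * _).
  by rewrite iterS /sdil/= addeC.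
exists (fun y => f (true, y)); first exact: nnmfun_pair.
by apply/funext => -[s y]; rewrite (expop_recl _ lC ng) -(f_even s).
Qed.

(* Every convolution power of (m, m) other than the zeroth is even in the sign, hence
   does not contribute to a primitive. *)
Lemma primitive_sexp_cancel A m x :
  primitive (sexp (sadd A (SMeasure m m))) x = primitive (sexp A) x.
Proof.
have nr := nnmfun_ray x; set C := SMeasure m m.
have [h nh expCE] := expop_sdil_diag m nr.
have nhs := nnmfun_even nh.
have expACE s : sdil (sexp (sadd A C)) (ray x) (s, 1%R) =
    sdil (sexp A) (ray x) (s, 1%R) + dil (sabs (sexp A)) h 1.
  rewrite sdil_sexp_add// [sdil (sexp C) _]sdil_sexp// expCE.
  by rewrite (sigma_linearD (sigma_linear_sdil _))// (sdil_even _ nh).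
have fin s B : sdil B (ray x) (s, 1%R) \is a fin_num by exact: sdil_ray_fin_num.
have finh : dil (sabs (sexp A)) h 1 \is a fin_num.
  by move: (fin true (sexp (sadd A C))); rewrite expACE fin_numD => /andP[].
rewrite !primitiveE (expACE true) (expACE false).
by rewrite (fineD (fin true _) finh) (fineD (fin false _) finh) opprD addrACA subrr addr0.
Qed.

(* No subtraction, as the values may be +oo on unbounded sets. *)
Definition smeasure_eq A B := forall X, measurable X ->
  spos A X + sneg B X = spos B X + sneg A X.

Lemma smeasure_eq_refl A : smeasure_eq A A.
Proof. by []. Qed.

Lemma smeasure_eq_sopp A B : smeasure_eq A B -> smeasure_eq (sopp A) (sopp B).
Proof. by move=> AB X mX; rewrite /= addeC -AB// addeC. Qed.

Lemma smeasure_eq_sadd A A' B B' : smeasure_eq A A' -> smeasure_eq B B' ->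
  smeasure_eq (sadd A B) (sadd A' B').
Proof. by move=> AA' BB' X mX; rewrite /= !lfm_addE addeACA AA'// BB'// addeACA. Qed.

Lemma eq_primitive_sexp A B : smeasure_eq A B ->
  primitive (sexp A) = primitive (sexp B).
Proof.
move=> AB; apply/funext => x; have nr := nnmfun_ray x.
rewrite -(primitive_sexp_cancel A (sneg B)) -(primitive_sexp_cancel B (sneg A)).
set A' := sadd A _; set B' := sadd B _.
have A'B' : sdil A' = sdil B'.
  by apply: eq_sdil => X mX; rewrite /= !lfm_addE ?AB// addeC.
by rewrite !primitiveE (sdil_sexp A' nr) (sdil_sexp B' nr) A'B'.
Qed.

Lemma le_sdil_flip A g h s x : nnmfun g -> nnmfun h -> (1 <= x)%R ->
  (forall t y, (1 <= y)%R -> g (t, y) <= g (~~ t, y) + h y) ->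
  sdil A g (s, x) <= sdil A g (~~ s, x) + dil (sabs A) h x.
Proof.
move=> ng nh x1 gh; have ngs t := nnmfun_pair t ng.
have le_dil_flip m t : dil m (fun y => g (t, y)) x <=
    dil m (fun y => g (~~ t, y)) x + dil m h x.
  rewrite -[leRHS]/((fun y => _ y + _ y) x) -dilD//.
  by apply: le_dil => //; [exact: nnmfunD|exact: gh].
by rewrite /sdil/= (dil_add _ _ _ nh) [leRHS]addeACA; apply: leeD; exact: le_dil_flip.
Qed.

Lemma spart_le_flip A s x :
  spart A s `[1%R, x]%classic <=
  spart A (~~ s) `[1%R, x]%classic + `|primitive A x|%:E.
Proof.
rewrite /primitive /signed_val; case: s => /=;
  rewrite -[leLHS]fineK ?lfm_fin_num// -[X in _ <= X + _]fineK ?lfm_fin_num//;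
  rewrite -EFinD lee_fin -lerBlDl.
- exact: ler_norm.
- by rewrite distrC ler_norm.
Qed.

Lemma measurable_primitive A : measurable_fun [set: R] (primitive A).
Proof.
apply: measurable_funB; apply: nondecreasing_measurable => // x y xy;
  apply: fine_le; rewrite ?lfm_fin_num//;
  by apply: le_measure; rewrite ?inE//=; apply: subset_itvl; rewrite bnd_simp.
Qed.

Lemma nnmfun_normr_primitive A x : nnmfun (fun u : R => `|primitive A (x / u)|%:E).
Proof.
apply: nnmfun_EFin => //; apply: measurableT_comp => //.
exact: (measurableT_comp (measurable_primitive A) (measurable_divr x)).
Qed.

Lemma normr_primitive_sexp_add_le A B x :
  `|primitive (sexp (sadd A B)) x|%:E <=
  \int[sabs (sexp B)]_u `|primitive (sexp A) (x / u)|%:E.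
Proof.
have nr := nnmfun_ray x; have nm := nnmfun_normr_primitive (sexp A) x.
pose g := sdil (sexp A) (ray x); have ng : nnmfun g by exact: nnmfun_sdil.
have gE s : sdil (sexp (sadd A B)) (ray x) (s, 1%R) = sdil (sexp B) g (s, 1%R).
  by rewrite (sdil_sexp_add A B nr) (sdilC _ _ nr).
have le_flip s : sdil (sexp B) g (s, 1%R) <= sdil (sexp B) g (~~ s, 1%R) +
    \int[sabs (sexp B)]_u `|primitive (sexp A) (x / u)|%:E.
  rewrite -dil1; apply: le_sdil_flip => // t y y1.
  by rewrite /g !sdil_ray ?(lt_le_trans ltr01)//; exact: spart_le_flip.
rewrite primitiveE !gE; apply: normr_fineB_le; rewrite -?gE ?sdil_ray_fin_num// !gE.
  exact: (le_flip true).
exact: (le_flip false).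
Qed.

Lemma primitive_lt1 A x : (x < 1)%R -> primitive A x = 0%R.
Proof.
move=> x1; rewrite /primitive /signed_val set_itv_ge ?bnd_simp -?ltNge//.
by rewrite !measure0 subrr.
Qed.

End primitive_of_exponential.

Section exponential_inequalities.
Local Open Scope ereal_scope.
Context {R : realType}.
Implicit Types (m : lfmeasure R) (A : smeasure R) (h : R -> \bar R) (x : R).

Lemma nnmfun_iter_dil m n h : nnmfun h -> nnmfun (iter n (dil m) h).
Proof. exact/nnmfun_iter/sigma_linear_dil. Qed.

Lemma integral_sabs_sexp A h : nnmfun h ->
  \int[sabs (sexp A)]_u h u = expop (dil (sabs A)) h 1%R.
Proof. by move=> nh; rewrite -dil1 dil_sabs_sexp. Qed.

Lemma expop_dil_le m (h : R -> R) (K : R) : (0 <= K)%R ->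
  nnmfun (fun u => (h u)%:E) ->
  (forall x, (1 <= x)%R -> dil m (fun u => (h u)%:E) x <= (K * h x)%:E) ->
  forall x, (1 <= x)%R -> expop (dil m) (fun u => (h u)%:E) x <= (expR K * h x)%:E.
Proof.
move=> K0 nh dil_le x x1.
have iter_le n y : (1 <= y)%R ->
    iter n (dil m) (fun u => (h u)%:E) y <= (K ^+ n * h y)%:E.
  elim: n y => [|n IH] y y1; first by rewrite expr0 mul1r.
  have pow_ge0 : 0 <= (K ^+ n)%:E by rewrite lee_fin exprn_ge0.
  apply: (@le_trans _ _ (dil m (fun u => (K ^+ n)%:E * (h u)%:E) y)).
    by apply: le_dil => //; [exact: nnmfun_iter_dil|exact: nnmfunZ].
  by rewrite (dilZ _ pow_ge0 nh) exprSr -mulrA EFinM lee_wpmul2l// dil_le.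
have h0 : (0 <= h x)%R by case: nh => _ /(_ x); rewrite lee_fin.
rewrite mulrC EFinM -nneseries_exp_coeff -nneseriesZl; last first.
  by move=> n _; rewrite lee_fin exp_coeff_ge0.
apply: lee_nneseries => [n _ _|n _].
  exact: expop_term_ge0 (sigma_linear_dil m) nh.
apply: (@le_trans _ _ (inv_fact n * (K ^+ n * h x)%:E)).
  by rewrite lee_wpmul2l ?inv_fact_ge0// iter_le.
by rewrite /inv_fact -!EFinM lee_fin exp_coeffE mulrA mulrC.
Qed.

Lemma integral_sexp_submul_le A (h : R -> R) (K : R) : (0 <= K)%R ->
  nnmfun (fun u => (h u)%:E) -> (h 1 <= 1)%R ->
  (forall x u, (1 <= x)%R -> (1 <= u)%R -> h (x * u) <= h x * h u)%R ->
  \int[sabs A]_u (h u)%:E <= K%:E ->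
  \int[sabs (sexp A)]_u (h u)%:E <= (expR K)%:E.
Proof.
move=> K0 nh h1 h_submul int_le.
have h0 x : (0 <= h x)%R by case: nh => _ /(_ x); rewrite lee_fin.
rewrite integral_sabs_sexp//; apply: (@le_trans _ _ (expR K * h 1)%:E); last first.
  by rewrite lee_fin ler_piMr ?expR_ge0.
apply: expop_dil_le => // x x1; rewrite mulrC EFinM.
apply: (@le_trans _ _ ((h x)%:E * \int[sabs A]_u (h u)%:E)); last first.
  by rewrite lee_wpmul2l// lee_fin.
rewrite -lfm_integralZl ?lee_fin//.
apply: le_lfm_integral => [||u u1]; first exact: (nnmfun_mulr x nh).
- by apply: nnmfunZ; rewrite ?lee_fin.
- by rewrite -EFinM lee_fin h_submul.
Qed.

(* The logarithm is taken in absolute value so as to be nonnegative off [1, oo[, where the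
   measures vanish. *)
Definition absln (u : R) : R := `|ln u|%R.

Lemma nnmfun_absln : nnmfun (fun u => (absln u)%:E).
Proof.
apply: nnmfun_EFin => [|u]; last exact: normr_ge0.
by apply: measurableT_comp => //; exact: measurable_ln.
Qed.

Lemma absln_ge0 u : (0 <= absln u)%R. Proof. exact: normr_ge0. Qed.

Lemma absln_mul_le x u : (0 < x)%R -> (0 < u)%R -> (absln (x * u) <= absln x + absln u)%R.
Proof. by move=> x0 u0; rewrite /absln lnM ?posrE// ler_normD. Qed.

Lemma nnmfun_wdil_absln m h : nnmfun h -> nnmfun (wdil m absln h).
Proof. exact/sigma_linear_nnmfun/sigma_linear_wdil/nnmfun_absln. Qed.

Lemma iter_dil_wdilC m h n : nnmfun h ->
  iter n (dil m) (wdil m absln h) = wdil m absln (iter n (dil m) h).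
Proof.
move=> nh; apply: commuting_op_iter => //; first exact: sigma_linear_dil.
rewrite -wdil_cst1; apply: wdilC; last exact: nnmfun_absln.
exact: (@nnmfun_cst _ _ _ 1).
Qed.

(* Leibniz rule: multiplication by log is a derivation for the convolution. *)
Lemma dil_absln_le m h x : nnmfun h -> (1 <= x)%R ->
  dil m (fun u => (absln u)%:E * h u) x <= (absln x)%:E * dil m h x + wdil m absln h x.
Proof.
move=> nh x1; have nxh := nnmfun_mulr x nh; have nl := nnmfun_absln.
have x0 : (0 < x)%R by exact: lt_le_trans x1.
have nxl : nnmfun (fun u => (absln x)%:E * h (x * u)%R).
  by apply: nnmfunZ => //; rewrite lee_fin absln_ge0.
have nlh := nnmfunM nl nxh; have [_ xh0] := nxh.
rewrite /dil /wdil -lfm_integralZl ?lee_fin ?absln_ge0// -lfm_integralD//.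
apply: le_lfm_integral => [||u u1].
- exact: (nnmfun_mulr x (nnmfunM nl nh)).
- exact: nnmfunD.
have u0 : (0 < u)%R by exact: lt_le_trans u1.
rewrite -ge0_muleDl ?lee_fin ?absln_ge0// lee_wpmul2r//.
by rewrite -EFinD lee_fin absln_mul_le.
Qed.

Lemma iter_dil_absln_le m h n x : nnmfun h -> (1 <= x)%R ->
  iter n (dil m) (fun u => (absln u)%:E * h u) x <=
  (absln x)%:E * iter n (dil m) h x + n%:R%:E * iter n.-1 (dil m) (wdil m absln h) x.
Proof.
move=> nh; have nl := nnmfun_absln; have nwh := nnmfun_wdil_absln m nh.
have niter k g : nnmfun g -> nnmfun (iter k (dil m) g) by exact: nnmfun_iter_dil.
have n0 k : 0 <= k%:R%:E :> \bar R by rewrite lee_fin.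
elim: n x => [|n IH] x x1; first by rewrite /= mul0e adde0.
have nlh := nnmfunM nl (niter n _ nh).
have nwn := nnmfunZ (n0 n) (niter n.-1 _ nwh).
rewrite iterS; apply: (@le_trans _ _ (dil m (fun y => (absln y)%:E * iter n (dil m) h y +
    n%:R%:E * iter n.-1 (dil m) (wdil m absln h) y) x)).
  by apply: le_dil => //; [exact/niter/nnmfunM|exact: nnmfunD].
rewrite (dilD _ nlh nwn) (dilZ _ (n0 n) (niter n.-1 _ nwh)).
apply: (le_trans (leeD2r _ (dil_absln_le m (niter n _ nh) x1))).
rewrite -(iter_dil_wdilC m n nh) -addeA leeD2l//=.
case: n {IH nlh nwn} => [|n]; first by rewrite mul0e adde0 mul1e.
by rewrite -iterS -[X in X + _ <= _]mul1e -ge0_muleDl ?lee_fin//.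
Qed.

Lemma expop_dil_absln_le m h : nnmfun h ->
  expop (dil m) (fun u => (absln u)%:E * h u) 1%R <=
  expop (dil m) (wdil m absln h) 1%R.
Proof.
move=> nh; have lm := sigma_linear_dil m; have nlh := nnmfunM nnmfun_absln nh.
have absln1 : absln 1 = 0%R by rewrite /absln ln1 normr0.
rewrite (expop_recl _ lm nlh) absln1 mul0e add0e.
apply: lee_nneseries => [n _ _|n _]; first exact: (expop_term_ge0 _ _ lm nlh).
rewrite -(inv_factS n) -muleA lee_wpmul2l ?inv_fact_ge0//.
have := iter_dil_absln_le m n.+1 nh (lexx 1%R).
by rewrite absln1 mul0e add0e.
Qed.

Lemma integral_sexp_absln_le A h : nnmfun h ->
  \int[sabs (sexp A)]_u ((absln u)%:E * h u) <=
  \int[sabs (sexp A)]_u wdil (sabs A) absln h u.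
Proof.
move=> nh; rewrite !integral_sabs_sexp; first exact: expop_dil_absln_le.
- exact: nnmfun_wdil_absln.
- exact/nnmfunM/nh/nnmfun_absln.
Qed.

End exponential_inequalities.

Section mass_function.
Context {R : realType}.
Implicit Types (m : lfmeasure R) (D : set R) (f g : R -> R) (a b c x y u : R).

Definition mass m x : R := fine (m `[1, x]%classic).

Lemma massE m x : m `[1, x]%classic = (mass m x)%:E.
Proof. by rewrite fineK// lfm_fin_num. Qed.

Lemma mass_ge0 m x : 0 <= mass m x.
Proof. exact: fine_ge0. Qed.

Lemma le_mass m : {homo mass m : x y / x <= y}.
Proof.
move=> x y xy; rewrite -lee_fin -!massE; apply: le_measure; rewrite ?inE//=.
by apply: subset_itvl; rewrite bnd_simp.
Qed.

Lemma integral_EFin_mkcond m D f :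
  (\int[m]_(u in D) (f u)%:E = \int[m]_u ((f \_ D) u)%:E)%E.
Proof. by rewrite integral_mkcond restrict_EFin. Qed.

Lemma nnmfun_EFin_restrict D f : measurable D -> measurable_fun [set: R] f ->
  (forall u, D u -> 0 <= f u) -> nnmfun (fun u => ((f \_ D) u)%:E).
Proof.
move=> mD mf f0; apply: nnmfun_EFin => [|u].
  by apply/(measurable_restrictT _ mD); exact: measurable_funTS.
by rewrite patchE; case: ifPn => // uD; apply: f0; rewrite inE in uD.
Qed.

Lemma nnmfun_inv_restrict D : measurable D -> D `<=` `[1, +oo[ ->
  nnmfun (fun u => ((GRing.inv \_ D) u)%:E).
Proof.
move=> mD D1; apply: nnmfun_EFin_restrict => //; first exact: measurable_invr.
by move=> u /D1; rewrite /= in_itv/= andbT; exact: ge1_invr_ge0.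
Qed.

Lemma nnmfun_inv_restrict_itv y : nnmfun (fun u => ((GRing.inv \_ `[1, y]) u)%:E).
Proof. by apply: nnmfun_inv_restrict => // u; rewrite /= !in_itv/= => /andP[->]. Qed.

Lemma le_integral_EFin m D f g : measurable D ->
  measurable_fun [set: R] f -> measurable_fun [set: R] g ->
  (forall u, D u -> 0 <= f u <= g u) ->
  (\int[m]_(u in D) (f u)%:E <= \int[m]_(u in D) (g u)%:E)%E.
Proof.
move=> mD mf mg fg; apply: ge0_le_integral => //.
- by move=> u Du; rewrite lee_fin; have /andP[] := fg u Du.
- exact/measurable_EFinP/measurable_funTS.
- exact/measurable_EFinP/measurable_funTS.
- by move=> u Du; rewrite lee_fin; have /andP[] := fg u Du.
Qed.

Lemma ge0_integral_EFinZl m D (k : R) f : measurable D -> 0 <= k ->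
  measurable_fun [set: R] f -> (forall u, D u -> 0 <= f u) ->
  (\int[m]_(u in D) (k * f u)%:E = k%:E * \int[m]_(u in D) (f u)%:E)%E.
Proof.
move=> mD k0 mf f0; under eq_integral do rewrite EFinM.
by rewrite ge0_integralZl_EFin//; exact/measurable_EFinP/measurable_funTS.
Qed.

Lemma integral_itv_le_mass m f a b c : 1 <= a -> 0 <= c ->
  measurable_fun [set: R] f -> (forall u, a <= u <= b -> 0 <= f u <= c) ->
  (\int[m]_(u in `[a, b]) (f u)%:E <= (c * mass m b)%:E)%E.
Proof.
move=> a1 c0 mf fc; apply: (@le_trans _ _ (\int[m]_(u in `[a, b]) (cst c u)%:E)%E).
  by apply: le_integral_EFin => // u; rewrite /= in_itv/=; exact: fc.
rewrite [leLHS](integral_cst m _ c%:E)// EFinM -massE lee_wpmul2l ?lee_fin//.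
by apply: le_measure; rewrite ?inE//=; apply: subset_itvr; rewrite bnd_simp.
Qed.

Lemma ge0_subset_integral_itvl m f a b c : b <= c -> measurable_fun [set: R] f ->
  (forall u, a <= u -> 0 <= f u) ->
  (\int[m]_(u in `[a, b]) (f u)%:E <= \int[m]_(u in `[a, c]) (f u)%:E)%E.
Proof.
move=> bc mf f0; apply: ge0_subset_integral => //.
- exact/measurable_EFinP/measurable_funTS.
- by move=> u; rewrite /= in_itv/= lee_fin => /andP[/f0].
- by apply: subset_itvl; rewrite bnd_simp.
Qed.

Lemma ge0_integral_itv_split_le m f a b c : a <= b -> b <= c ->
  measurable_fun [set: R] f -> (forall u, a <= u -> 0 <= f u) ->
  (\int[m]_(u in `[a, c]) (f u)%:E <=
   \int[m]_(u in `[a, b]) (f u)%:E + \int[m]_(u in `[b, c]) (f u)%:E)%E.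
Proof.
move=> ab bc mf f0; have mfE D : measurable_fun D (EFin \o f).
  exact/measurable_EFinP/measurable_funTS.
rewrite (_ : `[a, c]%classic = `[a, b] `|` `]b, c]); last first.
  by rewrite -itv_bndbnd_setU ?bnd_simp.
rewrite ge0_integral_setU//; last 2 first.
- move=> u [] /=; rewrite in_itv/= lee_fin => /andP[u1 _]; apply: f0 => //.
  exact: le_trans ab (ltW u1).
- apply/disj_setPS => u [] /=; rewrite !in_itv/= => /andP[_ ub] /andP[bu _].
  by move: (le_lt_trans ub bu); rewrite ltxx.
rewrite leeD2l//; apply: ge0_subset_integral => //.
  by move=> u; rewrite /= in_itv/= lee_fin => /andP[bu _]; apply: f0; exact: le_trans bu.
by apply: subset_itvr; rewrite bnd_simp.
Qed.

Lemma ge0_integral_log_scale_le m f a (c : nat -> R) n : 1 <= a ->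
  measurable_fun [set: R] f -> (forall u, 1 <= u -> 0 <= f u) ->
  (forall k, \int[m]_(u in `[(a * expR k%:R)%R, (a * expR k.+1%:R)%R]) (f u)%:E <=
    (c k)%:E)%E ->
  (\int[m]_(u in `[a, (a * expR n.+1%:R)%R]) (f u)%:E <= (\sum_(k < n.+1) c k)%:E)%E.
Proof.
move=> a1 mf f0 fc; elim: n => [|n IH].
  by rewrite big_ord1; have := fc 0%N; rewrite expR0 mulr1.
have a0 : 0 < a by exact: lt_le_trans a1.
rewrite big_ord_recr/= EFinD; apply: le_trans (leeD IH (fc n.+1)).
apply: ge0_integral_itv_split_le => //.
- by rewrite ler_peMr ?(ltW a0)// expR_ge1.
- by rewrite ler_pM2l// ler_expR ler_nat.
- by move=> u /(le_trans a1); exact: f0.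
Qed.

End mass_function.

Section logarithmic_decay.
Context {R : realType}.
Implicit Types (m : lfmeasure R) (a x y u v : R).

Definition logdecay a x : R := (1 + ln x) `^ (- a).

Lemma logdecay_ge0 a x : 0 <= logdecay a x.
Proof. exact: powR_ge0. Qed.

Lemma logdecay_le1 a x : 0 <= a -> 1 <= x -> logdecay a x <= 1.
Proof.
move=> a0 x1; rewrite -(powRr0 (1 + ln x)) ler_powR ?oppr_le0//.
by rewrite lerDl ln_ge0.
Qed.

Lemma logdecay_le a x y : 0 <= a -> 0 < y -> y <= 1 + ln x -> logdecay a x <= y `^ (- a).
Proof.
move=> a0 y0 yx; have x0 : 0 < 1 + ln x by exact: lt_le_trans yx.
rewrite /logdecay !powRN lef_pV2 ?posrE ?powR_gt0//.
by rewrite ge0_ler_powR ?nnegrE ?(ltW y0) ?(ltW x0).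
Qed.

Lemma mul_logdecay a x : 1 <= x -> (1 + ln x) * logdecay a x = (1 + ln x) `^ (1 - a).
Proof.
move=> x1; have ln1x0 : 0 < 1 + ln x by rewrite ltr_pwDl ?ln_ge0.
rewrite powRD; last by rewrite (gt_eqF ln1x0) implybT.
by rewrite powRr1 ?(ltW ln1x0).
Qed.

Lemma ge1_mul_logdecay a x : 0 <= a -> a <= 1 -> 1 <= x -> 1 <= x * logdecay a x.
Proof.
move=> a0 a1 x1; have x0 : 0 < x by exact: lt_le_trans x1.
have t1 : 1 <= 1 + ln x by rewrite lerDl ln_ge0.
have t0 : 0 < 1 + ln x by exact: lt_le_trans t1.
rewrite /logdecay powRN ler_pdivlMr ?powR_gt0// mul1r.
apply: (@le_trans _ _ ((1 + ln x) `^ 1)); first exact: ler_powR.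
rewrite powRr1 ?(ltW t0)// -lerBrDl.
by have := @le_ln1Dx R (x - 1); rewrite [1 + _]addrC subrK; apply; rewrite ltrBrDr addNr.
Qed.

Lemma logdecay_cvg0 a : 0 < a -> logdecay a x @[x --> +oo] --> (0 : R).
Proof.
move=> a0; apply/cvgr0Pnorm_le => eps eps0; near=> x.
pose y := eps `^ (- a^-1); have y0 : 0 < y by exact: powR_gt0.
have yE : y `^ (- a) = eps.
  by rewrite -powRrM mulrNN mulVf ?gt_eqF// powRr1 ?(ltW eps0).
rewrite ger0_norm ?logdecay_ge0// -[leRHS]yE logdecay_le ?(ltW a0)//.
have yx : expR y <= x by near: x; apply: nbhs_pinfty_ge; rewrite num_real.
have x0 : 0 < x by exact: lt_le_trans (expR_gt0 y) yx.
by rewrite ler_wpDl// -ler_expR lnK.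
Unshelve. all: by end_near. Qed.

Lemma measurable_logdecay_div a y :
  measurable_fun [set: R] (fun u : R => logdecay a (y / u)).
Proof.
apply: (measurableT_comp (measurable_powR _)); apply: measurable_funD => //.
by apply: (measurableT_comp (@measurable_ln R)); exact: measurable_divr.
Qed.

Definition logkernel a y u : R := u^-1 * logdecay a (y / u).

Lemma logkernel_ge0 a y u : 1 <= u -> 0 <= logkernel a y u.
Proof. by move=> u1; rewrite mulr_ge0 ?logdecay_ge0 ?ge1_invr_ge0. Qed.

Lemma measurable_logkernel a y : measurable_fun [set: R] (logkernel a y).
Proof.
by apply: measurable_funM; [exact: measurable_invr|exact: measurable_logdecay_div].
Qed.

Lemma measurable_ln_logkernel a y :
  measurable_fun [set: R] (fun u => ln u * logkernel a y u).
Proof. by apply: measurable_funM; [exact: measurable_ln|exact: measurable_logkernel]. Qed.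

Lemma ln_logkernel_ge0 a y u : 1 <= u -> 0 <= ln u * logkernel a y u.
Proof. by move=> u1; rewrite mulr_ge0 ?ln_ge0 ?logkernel_ge0. Qed.

Lemma nnmfun_logkernel_restrict a y :
  nnmfun (fun u => ((logkernel a y \_ `[1, y]) u)%:E).
Proof.
apply: nnmfun_EFin_restrict => //; first exact: measurable_logkernel.
by move=> u; rewrite /= in_itv/= => /andP[/logkernel_ge0].
Qed.

Lemma wdil_logkernel_le m a y v : 1 <= v ->
  (wdil m (@absln R) (fun u => ((logkernel a y \_ `[1, y]) u)%:E) v <=
   ((GRing.inv \_ `[1, y]) v)%:E *
   \int[m]_(u in `[1%R, (y / v)%R]) (ln u * logkernel a (y / v) u)%:E)%E.
Proof.
move=> v1; have v0 : 0 < v by exact: lt_le_trans v1.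
pose f u := ln u * logkernel a (y / v) u.
have nf : nnmfun (fun u => ((f \_ `[1, (y / v)%R]) u)%:E).
  apply: nnmfun_EFin_restrict => //; first exact: measurable_ln_logkernel.
  by move=> u; rewrite /= in_itv/= => /andP[u1 _]; exact: ln_logkernel_ge0.
have [_ f0] := nf; have [_ /(_ v) inv_ge0] := nnmfun_inv_restrict_itv y.
rewrite [X in (_ <= _ * X)%E]integral_EFin_mkcond -[leRHS](lfm_integralZl _ inv_ge0 nf).
apply: le_lfm_integral => [||u u1].
- exact: (nnmfunM nnmfun_absln (nnmfun_mulr v (nnmfun_logkernel_restrict a y))).
- exact: nnmfunZ.
have [vuy|vuy] := leP (v * u) y; last first.
  have -> : (logkernel a y \_ `[1, y]) (v * u) = 0.
    by rewrite patchE memNset//= in_itv/= [_ <= y]leNgt vuy andbF.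
  by rewrite mule0 mule_ge0.
have vy : v <= y by rewrite (le_trans _ vuy)// ler_peMr ?(ltW v0).
have uyv : u <= y / v by rewrite ler_pdivlMr// mulrC.
rewrite -!EFinM lee_fin !patchE !mem_set/= ?in_itv/= ?v1 ?u1 ?mulr_ege1//.
rewrite /f /logkernel /absln ger0_norm ?ln_ge0// invfM (mulrA y).
by rewrite -(mulrA v^-1) mulrCA.
Qed.

Lemma mul_integral_logkernel_le m a y : a <= 1 -> 1 <= y ->
  ((1 + ln y)%:E * \int[m]_u ((logkernel a y \_ `[1, y]) u)%:E <=
   \int[m]_u ((absln u)%:E * ((logkernel a y \_ `[1, y]) u)%:E) +
   ((1 + ln y) `^ (1 - a))%:E * \int[m]_u ((GRing.inv \_ `[1, y]) u)%:E)%E.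
Proof.
move=> a1 y1; have nk := nnmfun_logkernel_restrict a y.
have ni := nnmfun_inv_restrict_itv y; have y0 : 0 < y by exact: lt_le_trans y1.
have t0 : (0 <= (1 + ln y)%:E)%E by rewrite lee_fin addr_ge0 ?ln_ge0.
have pow_ge0 : (0 <= ((1 + ln y) `^ (1 - a))%:E)%E by rewrite lee_fin powR_ge0.
have nlk := nnmfunM nnmfun_absln nk; have npi := nnmfunZ pow_ge0 ni.
rewrite -(lfm_integralZl _ t0 nk) -(lfm_integralZl _ pow_ge0 ni).
rewrite -(lfm_integralD _ nlk npi).
apply: le_lfm_integral => [||u u1]; [exact: nnmfunZ|exact: nnmfunD|].
have u0 : 0 < u by exact: lt_le_trans u1.
rewrite -!EFinM -EFinD lee_fin !patchE; case: ifPn => [|_]; last by rewrite !mulr0 addr0.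
rewrite inE /= in_itv/= => /andP[_ uy].
have yu1 : 1 <= y / u by rewrite ler_pdivlMr ?mul1r.
have lnyE : 1 + ln y = ln u + (1 + ln (y / u)) by rewrite ln_div ?posrE//; ring.
rewrite {1}lnyE mulrDl /absln ger0_norm ?ln_ge0// lerD2l /logkernel mulrCA.
rewrite mul_logdecay// mulrC ler_wpM2r ?ge1_invr_ge0//.
by rewrite ge0_ler_powR ?subr_ge0 ?nnegrE ?addr_ge0 ?ln_ge0// lnyE lerDr ln_ge0//.
Qed.

End logarithmic_decay.

Section small_mass.
Context {R : realType}.
Variable e : lfmeasure R.
Implicit Types (a b d x y z u : R).

Hypothesis mass_smallo :
  (fun x : R => mass e x : R^o) =o_+oo (fun x : R => x / ln x : R^o).

Lemma mass_ln_small d : 0 < d ->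
  exists2 X, 1 <= X & forall x, X <= x -> mass e x * ln x <= d * x.
Proof.
move=> d0; move/eqoP : mass_smallo => /(_ d d0)[M [_ mass_le]].
exists (Num.max (expR 1) (M + 1)) => [|x].
  by rewrite le_max expR_ge1.
rewrite ge_max => /andP[ex Mx].
have x0 : 0 < x by exact: lt_le_trans (expR_gt0 1) ex.
have lnx0 : 0 < ln x by rewrite (lt_le_trans ltr01)// -ler_expR lnK.
have /= := mass_le x (lt_le_trans (ltr_pwDr ltr01 (lexx M)) Mx).
rewrite [X in _ * X]ger0_norm ?divr_ge0 ?(ltW x0) ?(ltW lnx0)// ger0_norm ?mass_ge0//.
by rewrite mulrA ler_pdivlMr.
Qed.

Lemma mass_ln_le : exists2 C, 0 <= C & forall x, 1 <= x -> mass e x * ln x <= C * x.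
Proof.
have [X X1 massX] := mass_ln_small ltr01.
have C0 : 0 <= mass e X * ln X by rewrite mulr_ge0 ?mass_ge0 ?ln_ge0.
exists (1 + mass e X * ln X) => [|x x1]; first by rewrite addr_ge0.
have [/massX Xx|/ltW xX] := leP X x.
  by rewrite (le_trans Xx)// ler_wpM2r ?lerDl// (le_trans _ x1).
apply: (@le_trans _ _ (mass e X * ln X)).
  by rewrite ler_pM ?mass_ge0 ?ln_ge0 ?le_mass// ler_ln ?posrE// (lt_le_trans ltr01).
by rewrite (le_trans (ler_peMr _ x1))// ler_wpM2r ?lerDr// (le_trans _ x1).
Qed.

Lemma integral_inv_scale_le x : 1 <= x ->
  (\int[e]_(u in `[x, (x * expR 1)%R]) (u^-1)%:E <= (x^-1 * mass e (x * expR 1))%:E)%E.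
Proof.
move=> x1; have x0 : 0 < x by exact: lt_le_trans x1.
apply: integral_itv_le_mass => //; first exact: ge1_invr_ge0.
  exact: measurable_invr.
move=> u /andP[xu _]; have u0 : 0 < u by exact: lt_le_trans xu.
by rewrite ge1_invr_ge0 ?(le_trans x1)//= lef_pV2.
Qed.

Lemma integral_ln_div_scale_le : exists2 C, 0 <= C & forall x, 1 <= x ->
  (\int[e]_(u in `[x, (x * expR 1)%R]) (ln u / u)%:E <= C%:E)%E.
Proof.
have [C C0 massC] := mass_ln_le.
exists (C * expR 1) => [|x x1]; first by rewrite mulr_ge0 ?expR_ge0.
have x0 : 0 < x by exact: lt_le_trans x1.
have ex1 : 1 <= x * expR 1 by rewrite mulr_ege1// expR_ge1.
apply: (le_trans (@integral_itv_le_mass _ e _ x _ (ln (x * expR 1) / x) x1 _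
  measurable_ln_div _)).
- by rewrite divr_ge0 ?ln_ge0 ?(ltW x0).
- move=> u /andP[xu ux]; have u1 := le_trans x1 xu.
  have u0 : 0 < u by exact: lt_le_trans xu.
  rewrite ln_div_ge0//= ler_pM ?ln_ge0 ?ge1_invr_ge0//.
    by rewrite ler_ln// posrE (lt_le_trans ltr01).
  by rewrite lef_pV2.
rewrite lee_fin mulrAC ler_pdivrMr// mulrC.
by rewrite (le_trans (massC _ ex1))// -mulrA (mulrC x).
Qed.

Lemma integral_ln_div_le : exists2 C, 0 <= C & forall a b, 1 <= a -> a <= b ->
  (\int[e]_(u in `[a, b]) (ln u / u)%:E <= (C * (1 + ln (b / a)))%:E)%E.
Proof.
have [C C0 scale_le] := integral_ln_div_scale_le.
exists C => // a b a1 ab; have a0 : 0 < a by exact: lt_le_trans a1.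
have ba1 : 1 <= b / a by rewrite ler_pdivlMr ?mul1r.
have b0 : 0 < b by exact: lt_le_trans ab.
set n := Num.truncn (ln (b / a)).
have /andP[nl ln_n] := truncn_itv (ln_ge0 ba1).
apply: (@le_trans _ _ (\int[e]_(u in `[a, (a * expR n.+1%:R)%R]) (ln u / u)%:E)%E).
  apply: ge0_subset_integral_itvl => //; last by move=> u /(le_trans a1)/ln_div_ge0.
    by rewrite mulrC -ler_pdivrMr// -[leLHS]lnK ?posrE ?divr_gt0// ler_expR ltW.
  exact: measurable_ln_div.
apply: (@le_trans _ _ (\sum_(k < n.+1) C)%:E).
  apply: ge0_integral_log_scale_le => //; [exact: measurable_ln_div|exact: ln_div_ge0|].
  move=> k; have ek1 : 1 <= a * expR k%:R by rewrite mulr_ege1// expR_ge1.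
  by have := scale_le _ ek1; rewrite -mulrA -expRD natr1.
by rewrite lee_fin sumr_const card_ord -mulr_natr ler_wpM2l// -natr1 addrC lerD2l.
Qed.

Lemma integral_inv_expR_le d : 0 < d -> exists2 N, (0 < N)%N & forall n, (N <= n)%N ->
  (\int[e]_(u in `[expR n%:R, expR n.+1%:R]) (u^-1)%:E <=
   (d * (ln n.+1%:R - ln n%:R))%:E)%E.
Proof.
move=> d0; have [X X1 massX] := mass_ln_small (divr_gt0 d0 (expR_gt0 1)).
exists (Num.truncn X).+1 => // n Xn.
have n0 : 0 < n%:R :> R by rewrite ltr0n (leq_trans _ Xn).
have expn1 : 1 <= expR n%:R :> R by rewrite expR_ge1 ?ltW.
have expSn : expR n.+1%:R = expR n%:R * expR 1 :> R by rewrite -expRD natr1.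
rewrite expSn; apply: (le_trans (integral_inv_scale_le expn1)).
rewrite lee_fin -[in ln n.+1%:R]natr1.
apply: le_trans (ler_wpM2l (ltW d0) (inv_le_lnB n0)).
rewrite ler_pdivlMr ?addr_gt0// -mulrA mulrC ler_pdivrMr ?expR_gt0//.
have := massX (expR n%:R * expR 1); rewrite mulrCA divfK ?gt_eqF ?expR_gt0//.
rewrite -expRD expRK mulrC (mulrC d); apply.
have /andP[_ /ltW XSn] := truncn_itv (le_trans ler01 X1).
rewrite (le_trans XSn)// (le_trans _ (expR_ge1Dx _))// addrC -addrA ler_wpDr//.
by rewrite ler_nat.
Qed.

Lemma integral_inv_expR_log_le d : 0 < d -> exists2 C, 0 <= C & forall n, (0 < n)%N ->
  (\int[e]_(u in `[1%R, expR n%:R]) (u^-1)%:E <= (C + d * ln n%:R)%:E)%E.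
Proof.
move=> d0; have [N N0 scale_le] := integral_inv_expR_le d0; pose Z := expR N%:R : R.
have Z1 : 1 <= Z by exact: expR_ge1.
have Z0 : 0 < Z by exact: expR_gt0.
have minv := @measurable_invr R.
have inv_ge0 u : 1 <= u -> 0 <= u^-1 by exact: ge1_invr_ge0.
have head_le y : y <= Z -> (\int[e]_(u in `[1%R, y]) (u^-1)%:E <= (mass e Z)%:E)%E.
  move=> yZ; apply: (@le_trans _ _ (1 * mass e y)%:E); last first.
    by rewrite mul1r lee_fin le_mass.
  apply: integral_itv_le_mass => // u /andP[u1 _].
  by rewrite inv_ge0//= invf_le1// (lt_le_trans ltr01).
exists (mass e Z) => [|n n0]; first exact: mass_ge0.
have dln_ge0 : 0 <= d * ln n%:R by rewrite mulr_ge0 ?(ltW d0)// ln_ge0// ler1n.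
have [nN|Nn] := leqP n N.
  by apply: le_trans (head_le _ _) _; rewrite ?lee_fin ?lerDl// ler_expR ler_nat.
have -> : n = (N + (n - N.+1).+1)%N by rewrite -addSnnS subnKC.
set k := (n - N.+1)%N; pose c i := d * (ln (N + i.+1)%:R - ln (N + i)%:R).
have scale_leN i : (\int[e]_(u in `[(Z * expR i%:R)%R, (Z * expR i.+1%:R)%R]) (u^-1)%:E <=
    (c i)%:E)%E.
  by have := scale_le _ (leq_addr i N); rewrite /c /Z -!expRD -!natrD !addnS.
rewrite natrD expRD; apply: (le_trans (ge0_integral_itv_split_le e Z1 _ minv inv_ge0)).
  by rewrite ler_peMr ?(ltW Z0)// expR_ge1.
apply: (le_trans (leeD (head_le _ (lexx Z))
  (ge0_integral_log_scale_le k Z1 minv inv_ge0 scale_leN))).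
rewrite -EFinD lee_fin lerD2l -mulr_sumr ler_wpM2l ?(ltW d0)//.
rewrite -(big_mkord xpredT (fun i => ln (N + i.+1)%:R - ln (N + i)%:R)) telescope_sumr//.
by rewrite -natrD lerBlDr lerDl ln_ge0// addn0 ler1n.
Qed.

Lemma integral_inv_le d : 0 < d -> exists2 C, 0 <= C & forall y, 1 <= y ->
  (\int[e]_(u in `[1%R, y]) (u^-1)%:E <= (C + d * ln (1 + ln y))%:E)%E.
Proof.
move=> d0; have [C C0 inv_expR_le] := integral_inv_expR_log_le d0; exists C => // y y1.
have y0 : 0 < y by exact: lt_le_trans y1.
have /andP[nl ln_n] := truncn_itv (ln_ge0 y1); set n := Num.truncn (ln y) in nl ln_n.
apply: (@le_trans _ _ (\int[e]_(u in `[1%R, expR n.+1%:R]) (u^-1)%:E)%E).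
  apply: ge0_subset_integral_itvl; last exact: ge1_invr_ge0.
    by rewrite -(lnK y0) ler_expR ltW.
  exact: measurable_invr.
apply: (le_trans (inv_expR_le n.+1 isT)); rewrite lee_fin lerD2l ler_wpM2l ?(ltW d0)//.
by rewrite ler_ln ?posrE ?ltr0n ?ltr_pwDl ?ln_ge0// -natr1 addrC lerD2l.
Qed.

Section splitting.
Variables a C : R.
Hypotheses (a0 : 0 <= a) (C0 : 0 <= C).
Hypothesis ln_div_le : forall x y, 1 <= x -> x <= y ->
  (\int[e]_(u in `[x, y]) (ln u / u)%:E <= (C * (1 + ln (y / x)))%:E)%E.

Lemma integral_ln_logkernel_upper_le w z T : 1 <= w -> w <= z -> z <= w * expR T ->
  (\int[e]_(u in `[w, z]) (ln u * logkernel a z u)%:E <= (C * (1 + T))%:E)%E.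
Proof.
move=> w1 wz zwT; have w0 : 0 < w by exact: lt_le_trans w1.
apply: (@le_trans _ _ (\int[e]_(u in `[w, z]) (ln u / u)%:E)%E).
  apply: le_integral_EFin => // [||u].
  - exact: measurable_ln_logkernel.
  - exact: measurable_ln_div.
  rewrite /= in_itv/= => /andP[wu uz]; have u1 : 1 <= u by exact: le_trans wu.
  rewrite ln_logkernel_ge0//= /logkernel [leLHS]mulrA.
  rewrite ler_piMr ?ln_div_ge0// logdecay_le1//.
  by rewrite ler_pdivlMr ?mul1r// (lt_le_trans ltr01).
apply: (le_trans (ln_div_le w1 wz)); rewrite lee_fin ler_wpM2l// lerD2l.
by rewrite -ler_expR lnK ?posrE ?divr_gt0 ?(lt_le_trans w0)// ler_pdivrMr// mulrC.
Qed.

Lemma integral_ln_logkernel_lower_le w z T : 0 < T -> 1 <= w -> w * expR T <= z ->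
  (\int[e]_(u in `[1%R, w]) (ln u * logkernel a z u)%:E <=
   (C * (T `^ (- a) * (1 + ln z)))%:E)%E.
Proof.
move=> T0 w1 wTz; have w0 : 0 < w by exact: lt_le_trans w1.
have wz : w <= z by rewrite (le_trans _ wTz)// ler_peMr ?(ltW w0)// expR_ge1 ?ltW.
have z0 : 0 < z by exact: lt_le_trans wz.
apply: (@le_trans _ _ (\int[e]_(u in `[1%R, w]) (T `^ (- a) * (ln u / u))%:E)%E).
  apply: le_integral_EFin => // [||u].
  - exact: measurable_ln_logkernel.
  - by apply: measurable_funM => //; exact: measurable_ln_div.
  rewrite /= in_itv/= => /andP[u1 uw]; have u0 : 0 < u by exact: lt_le_trans u1.
  rewrite ln_logkernel_ge0//= /logkernel [leLHS]mulrA [leLHS]mulrC.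
  rewrite ler_wpM2r ?ln_div_ge0// logdecay_le// -[leLHS]add0r lerD//.
  rewrite -ler_expR lnK ?posrE ?divr_gt0// ler_pdivlMr// mulrC.
  by rewrite (le_trans _ wTz)// ler_wpM2r ?expR_ge0.
rewrite ge0_integral_EFinZl ?powR_ge0//; last 2 first.
- exact: measurable_ln_div.
- by move=> u; rewrite /= in_itv/= => /andP[/ln_div_ge0].
rewrite mulrCA [leRHS]EFinM lee_wpmul2l ?lee_fin ?powR_ge0//.
apply: (le_trans (ln_div_le (lexx 1) w1)); rewrite lee_fin ler_wpM2l// divr1.
by rewrite lerD2l ler_ln ?posrE.
Qed.

(* Split at u = z exp (- T): logdecay a (z / u) is at most T^(- a) below, 1 above. *)
Lemma integral_ln_logkernel_split_le z T : 0 < T -> 1 <= z ->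
  (\int[e]_(u in `[1%R, z]) (ln u * logkernel a z u)%:E <=
   (C * (T `^ (- a) * (1 + ln z) + (1 + T)))%:E)%E.
Proof.
move=> T0 z1; set w := z * expR (- T); have wTE : w * expR T = z.
  by rewrite -mulrA -expRD addNr expR0 mulr1.
have [w1|/ltW w1] := leP 1 w; last first.
  apply: (le_trans (@integral_ln_logkernel_upper_le 1 z T (lexx 1) z1 _)).
    by rewrite -wTE ler_wpM2r ?expR_ge0.
  by rewrite lee_fin ler_wpM2l// lerDr mulr_ge0 ?powR_ge0 ?addr_ge0 ?ln_ge0.
have wz : w <= z by rewrite -[leRHS]wTE ler_peMr ?(le_trans ler01)// expR_ge1 ?ltW.
apply: (le_trans (ge0_integral_itv_split_le e w1 wz (measurable_ln_logkernel a z)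
  (ln_logkernel_ge0 a z))).
have wTz : w * expR T <= z by rewrite wTE.
have zTw : z <= w * expR T by rewrite wTE.
have lower_le := integral_ln_logkernel_lower_le T0 w1 wTz.
have upper_le := integral_ln_logkernel_upper_le w1 wz zTw.
by apply: (le_trans (leeD lower_le upper_le)); rewrite -EFinD -mulrDr.
Qed.

End splitting.

Lemma integral_ln_logkernel_le a : 0 < a -> a <= 1 ->
  exists2 C, 0 <= C & forall z, 1 <= z ->
  (\int[e]_(u in `[1%R, z]) (ln u * logkernel a z u)%:E <=
   (C * (1 + ln z) `^ (1 - a / 2))%:E)%E.
Proof.
move=> a0 a1; have [C C0 ln_div_le] := integral_ln_div_le.
exists (3 * C) => [|z z1]; first by rewrite mulr_ge0.
set t := 1 + ln z; have t1 : 1 <= t by rewrite lerDl ln_ge0.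
have t0 : 0 < t by exact: lt_le_trans t1.
have T0 : 0 < t `^ 2^-1 by exact: powR_gt0.
apply: (le_trans (integral_ln_logkernel_split_le (ltW a0) C0 ln_div_le T0 z1)).
have half_le : 2^-1 <= 1 - a / 2 by lra.
have T_le : t `^ 2^-1 <= t `^ (1 - a / 2) by exact: ler_powR.
have one_le : 1 <= t `^ (1 - a / 2).
  by rewrite -[leLHS](powRr0 t) ler_powR// (le_trans _ half_le).
have TtE : (t `^ 2^-1) `^ (- a) * t = t `^ (1 - a / 2).
  rewrite -powRrM -[X in _ * X](powRr1 (ltW t0)) -powRD; last first.
    by apply/implyP => _; rewrite gt_eqF.
  by congr (_ `^ _); ring.
by rewrite lee_fin TtE (mulrC 3) -mulrA ler_wpM2l//; lra.
Qed.

End small_mass.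

Section integrals_of_exponential.
Context {R : realType}.
Implicit Types (A : smeasure R) (D : set R) (x y u : R).

Lemma integral_sexp_inv_le A D (K : R) : 0 <= K -> measurable D ->
  D `<=` `[1, +oo[ -> D 1 ->
  (forall x u, 1 <= x -> 1 <= u -> D (x * u) -> D x /\ D u) ->
  (\int[sabs A]_(u in D) (u^-1)%:E <= K%:E)%E ->
  (\int[sabs (sexp A)]_(u in D) (u^-1)%:E <= (expR K)%:E)%E.
Proof.
move=> K0 mD Dge1 D1 DM invK; rewrite integral_EFin_mkcond in invK.
rewrite integral_EFin_mkcond.
have nh := nnmfun_inv_restrict mD Dge1.
have h0 u : 0 <= (GRing.inv \_ D) u by case: nh => _ /(_ u); rewrite lee_fin.
apply: integral_sexp_submul_le => //; first by rewrite patchE mem_set// invr1.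
move=> x u x1 u1; have [xuD|xuD] := pselect (D (x * u)); last first.
  by rewrite patchE memNset// mulr_ge0.
by have [Dx Du] := DM _ _ x1 u1 xuD; rewrite !patchE !mem_set// invfM.
Qed.

Lemma integral_sexp_inv_itv_le A y (K : R) : 0 <= K -> 1 <= y ->
  (\int[sabs A]_(u in `[1%R, y]) (u^-1)%:E <= K%:E)%E ->
  (\int[sabs (sexp A)]_(u in `[1%R, y]) (u^-1)%:E <= (expR K)%:E)%E.
Proof.
move=> K0 y1; apply: integral_sexp_inv_le => //=.
- by move=> u /=; rewrite !in_itv/= => /andP[->].
- by rewrite in_itv/= lexx.
- move=> x u x1 u1; rewrite !in_itv/= x1 u1/= => /andP[_ xuy].
  have [x0 u0] : 0 <= x /\ 0 <= u by rewrite !(le_trans ler01).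
  by split; apply: le_trans xuy; rewrite ?ler_peMr ?ler_peMl.
Qed.

Lemma integral_sexp_inv_lt_pinfty A :
  (\int[sabs A]_(u in `[1%R, +oo[) (u^-1)%:E < +oo ->
   \int[sabs (sexp A)]_(u in `[1%R, +oo[) (u^-1)%:E < +oo)%E.
Proof.
set I := (\int[_]_(_ in _) _)%E => I_fin.
have I0 : (0 <= I)%E.
  apply: integral_ge0 => u; rewrite /= in_itv/= andbT lee_fin.
  exact: ge1_invr_ge0.
apply: (@le_lt_trans _ _ (expR (fine I))%:E); last exact: ltry.
apply: integral_sexp_inv_le => //=; first exact: fine_ge0.
- by rewrite in_itv/= lexx.
- by move=> x u x1 u1 _; rewrite !in_itv/= x1 u1.
- by rewrite fineK// ge0_fin_numE.
Qed.

End integrals_of_exponential.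

Section exponential_of_small_mass.
Context {R : realType}.
Variable A : smeasure R.
Local Notation e := (sabs A).
Local Notation F := (sabs (sexp A)).
Implicit Types a y u : R.

Hypothesis mass_smallo :
  (fun x : R => mass e x : R^o) =o_+oo (fun x : R => x / ln x : R^o).

Lemma integral_sexp_inv_powR a : 0 < a -> exists2 C, 0 <= C & forall y, 1 <= y ->
  (\int[F]_(u in `[1%R, y]) (u^-1)%:E <= (C * (1 + ln y) `^ a)%:E)%E.
Proof.
move=> a0; have [C C0 inv_le] := integral_inv_le mass_smallo a0.
exists (expR C) => [|y y1]; first exact: expR_ge0.
have ln1y : 0 < 1 + ln y by rewrite ltr_pwDl ?ln_ge0.
rewrite /powR gt_eqF// -expRD; apply: integral_sexp_inv_itv_le (inv_le _ y1) => //.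
by rewrite addr_ge0// mulr_ge0 ?(ltW a0)// ln_ge0// lerDl ln_ge0.
Qed.

Lemma integral_sexp_absln_logkernel_le a : 0 < a -> a <= 1 ->
  exists2 C, 0 <= C & forall y, 1 <= y ->
  (\int[F]_u ((absln u)%:E * ((logkernel a y \_ `[1, y]) u)%:E) <=
   (C * (1 + ln y) `^ (1 - a / 2))%:E * \int[F]_u ((GRing.inv \_ `[1, y]) u)%:E)%E.
Proof.
move=> a0 a1; have [C C0 ln_logkernel_le] := integral_ln_logkernel_le mass_smallo a0 a1.
exists C => // y y1; have nk := nnmfun_logkernel_restrict a y.
have ni := nnmfun_inv_restrict_itv y.
have coef_ge0 : (0 <= (C * (1 + ln y) `^ (1 - a / 2))%:E)%E.
  by rewrite lee_fin mulr_ge0 ?powR_ge0.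
apply: (le_trans (integral_sexp_absln_le A nk)); rewrite -(lfm_integralZl _ coef_ge0 ni).
apply: le_lfm_integral => [||v v1]; [exact: nnmfun_wdil_absln|exact: nnmfunZ|].
apply: (le_trans (wdil_logkernel_le e a y v1)).
have [vy|yv] := leP v y; last first.
  have -> : (GRing.inv \_ `[1, y]) v = 0.
    by rewrite patchE memNset//= in_itv/= [_ <= y]leNgt yv andbF.
  by rewrite mul0e mule0.
have v0 : 0 < v by exact: lt_le_trans v1.
have yv1 : 1 <= y / v by rewrite ler_pdivlMr ?mul1r.
rewrite [leRHS]muleC; apply: lee_wpmul2l; first by case: ni.
apply: (le_trans (ln_logkernel_le _ yv1)); rewrite lee_fin ler_wpM2l// ge0_ler_powR//.
- lra.
- by rewrite nnegrE addr_ge0 ?ln_ge0.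
- by rewrite nnegrE addr_ge0 ?ln_ge0.
- rewrite lerD2l ler_ln ?posrE ?divr_gt0 ?(lt_le_trans v0)//.
  by rewrite ler_pdivrMr// ler_peMr// (le_trans _ y1).
Qed.

Lemma integral_sexp_logkernel_le a : 0 < a -> a <= 1 ->
  exists2 C, 0 <= C & forall y, 1 <= y ->
  (\int[F]_(u in `[1%R, y]) (logkernel a y u)%:E <= (C * logdecay (a / 4) y)%:E)%E.
Proof.
move=> a0 a1; have [C C0 absln_le] := integral_sexp_absln_logkernel_le a0 a1.
have a40 : 0 < a / 4 by rewrite divr_gt0.
have [K K0 inv_le] := integral_sexp_inv_powR a40.
exists ((C + 1) * K) => [|y y1]; first by rewrite mulr_ge0// addr_ge0.
set t := 1 + ln y; have t1 : 1 <= t by rewrite lerDl ln_ge0.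
have t0 : 0 < t by exact: lt_le_trans t1.
have coef_ge0 : 0 <= C * t `^ (1 - a / 2) by rewrite mulr_ge0 ?powR_ge0.
set J := (\int[_]_(_ in _) _)%E.
have tJ_le : (t%:E * J <= ((C + 1) * t `^ (1 - a / 2) * (K * t `^ (a / 4)))%:E)%E.
  have := mul_integral_logkernel_le F a1 y1.
  rewrite -!integral_EFin_mkcond => /le_trans; apply.
  apply: (le_trans (leeD2r _ (absln_le y y1))); rewrite -integral_EFin_mkcond.
  rewrite -ge0_muleDl ?lee_fin ?powR_ge0// [leRHS]EFinM; apply: lee_pmul.
  - by rewrite -EFinD lee_fin addr_ge0 ?powR_ge0.
  - apply: integral_ge0 => u; rewrite /= in_itv/= lee_fin => /andP[u1 _].
    exact: ge1_invr_ge0.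
  - by rewrite -EFinD lee_fin mulrDl mul1r lerD2l ler_powR//; lra.
  - exact: inv_le.
have decayE : logdecay (a / 4) y = t^-1 * (t `^ (1 - a / 2) * t `^ (a / 4)).
  rewrite -(powR_inv1 (ltW t0)) -!powRD ?(gt_eqF t0) ?implybT//.
  by congr (_ `^ _); field.
move: tJ_le; rewrite -lee_pdivlMl// => /le_trans; apply; rewrite -EFinM lee_fin decayE.
by rewrite mulrACA [leRHS]mulrCA.
Qed.

End exponential_of_small_mass.

Section logarithmic_asymptotics.
Context {R : realType}.
Implicit Types (a x : R) (f : R -> R).

Lemma bigO_div_powR_logdecay f a : 0 < a ->
  (fun x : R => f x : R^o) =O_+oo (fun x : R => x / (ln x) `^ a : R^o) ->
  (fun x : R => f x : R^o) =O_+oo (fun x : R => x * logdecay (Num.min a 1) x : R^o).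
Proof.
move=> a0 /eqO_exP[k k0 fk]; apply/eqO_exP; exists (k * 2); first by rewrite mulr_gt0.
near=> x.
have ex : expR 1 <= x by near: x; apply: nbhs_pinfty_ge; rewrite num_real.
have x0 : 0 < x by exact: lt_le_trans (expR_gt0 1) ex.
have lnx1 : 1 <= ln x by rewrite -ler_expR lnK.
have lnx0 : 0 < ln x by exact: lt_le_trans lnx1.
apply: (@le_trans _ _ (k * `|x / ln x `^ a|)); first by near: x.
rewrite -mulrA ler_wpM2l ?(ltW k0)// !normrM (ger0_norm (ltW x0)).
rewrite mulrCA ler_wpM2l ?(ltW x0)//.
set b := Num.min a 1; have b0 : 0 < b by rewrite lt_min a0 ltr01.
have [ba b1] : b <= a /\ b <= 1 by rewrite !ge_min !lexx orbT.
rewrite normfV !ger0_norm ?powR_ge0 ?logdecay_ge0//.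
rewrite /logdecay powRN -[2]invrK -invfM lef_pV2 ?posrE ?mulr_gt0 ?powR_gt0 ?addr_gt0//.
rewrite mulrC ler_pdivrMr// (le_trans (@ge0_ler_powR _ _ (ltW b0) _ (ln x * 2) _ _ _))//.
- by rewrite nnegrE addr_ge0 ?(ltW lnx0).
- by rewrite nnegrE mulr_ge0 ?(ltW lnx0).
- by rewrite mulr_natr mulr2n lerD2r.
rewrite powRM ?(ltW lnx0)// ler_pM ?powR_ge0 ?ler_powR//.
by rewrite -[leRHS]powRr1// ler_powR// ler1n.
Unshelve. all: by end_near. Qed.

Lemma littleo_idP f :
  (fun x : R => f x : R^o) =o_+oo (fun x : R => x : R^o) <->
  `|f x| / x @[x --> +oo] --> (0 : R).
Proof.
split=> [/eqoP fo|/cvgr0Pnorm_le f0].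
  apply/cvgr0Pnorm_le => eps eps0; near=> x.
  have x0 : 0 < x by near: x; apply: nbhs_pinfty_gt; rewrite num_real.
  rewrite ger0_norm ?divr_ge0 ?(ltW x0)// ler_pdivrMr// -[X in _ <= _ * X]gtr0_norm//.
  by near: x; exact: fo.
apply/eqoP => eps eps0; near=> x.
have x0 : 0 < x by near: x; apply: nbhs_pinfty_gt; rewrite num_real.
rewrite (gtr0_norm x0) -ler_pdivrMr// -[leLHS]ger0_norm ?divr_ge0 ?(ltW x0)//.
by near: x; exact: f0.
Unshelve. all: by end_near. Qed.

End logarithmic_asymptotics.

Section perturbation.
Context {R : realType}.
Implicit Types (A B : smeasure R) (a x u : R) (phi f : R -> R).

Lemma normr_primitive_le A x : `|primitive A x| <= mass (sabs A) x.
Proof.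
rewrite /mass lfm_addE fineD ?lfm_fin_num//; apply: le_trans (ler_normB _ _) _.
by rewrite !ger0_norm ?fine_ge0.
Qed.

Lemma primitive_bigO_le A phi : (forall x, 1 <= x -> 1 <= phi x) ->
  (fun x : R => primitive A x : R^o) =O_+oo (fun x : R => phi x : R^o) ->
  exists2 C, 0 <= C & forall x, 1 <= x -> `|primitive A x| <= C * phi x.
Proof.
move=> phi1 /eqO_exP[k k0 [M [_ A_le]]]; have mM0 := mass_ge0 (sabs A) M.
exists (k + mass (sabs A) M) => [|x x1]; first by rewrite addr_ge0 ?(ltW k0).
have phix0 : 0 <= phi x by rewrite (le_trans ler01)// phi1.
rewrite mulrDl; have [xM|Mx] := leP x M.
  apply: ler_wpDl; first by rewrite mulr_ge0 ?(ltW k0).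
  rewrite (le_trans (normr_primitive_le A x))// (le_trans (le_mass _ xM))//.
  by rewrite ler_peMr ?phi1.
apply: ler_wpDr; first by rewrite mulr_ge0.
by have := A_le x Mx; rewrite /= (ger0_norm phix0).
Qed.

Definition primitive_ratio A x : R := `|primitive A x| / x.

Lemma primitive_ratio_lt1 A x : x < 1 -> primitive_ratio A x = 0.
Proof. by move=> x1; rewrite /primitive_ratio primitive_lt1// normr0 mul0r. Qed.

Lemma primitive_ratio_ge0 A x : 0 <= primitive_ratio A x.
Proof.
have [/primitive_ratio_lt1-> //|x1] := ltP x 1.
by rewrite divr_ge0// (le_trans ler01).
Qed.

Lemma measurable_primitive_ratio A : measurable_fun [set: R] (primitive_ratio A).
Proof.
apply: measurable_funM; last exact: measurable_invr.
by apply: measurableT_comp => //; exact: measurable_primitive.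
Qed.

Lemma measurable_inv_primitive_ratio_div A x :
  measurable_fun [set: R] (fun u => u^-1 * primitive_ratio A (x / u)).
Proof.
apply: measurable_funM; first exact: measurable_invr.
exact: measurableT_comp (measurable_primitive_ratio A) (measurable_divr x).
Qed.

Lemma primitive_ratio_sexp_add_le A B x : 0 < x ->
  ((primitive_ratio (sexp (sadd A B)) x)%:E <= \int[sabs (sexp B)]_(u in `[1%R, +oo[)
    (u^-1 * primitive_ratio (sexp A) (x / u))%:E)%E.
Proof.
move=> x0; rewrite /primitive_ratio mulrC EFinM lee_pdivrMl//.
apply: (le_trans (normr_primitive_sexp_add_le A B x)).
rewrite lfm_integralE; last exact: nnmfun_normr_primitive.
rewrite -(ge0_integral_EFinZl (sabs (sexp B)) (measurable_itv `[1, +oo[) (ltW x0)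
  (measurable_inv_primitive_ratio_div (sexp A) x)); last first.
  move=> u; rewrite /= in_itv/= andbT => u1.
  by rewrite mulr_ge0 ?primitive_ratio_ge0 ?ge1_invr_ge0.
apply: le_integral_EFin => // [||u].
- by apply/measurable_EFinP; case: (nnmfun_normr_primitive (sexp A) x).
- by apply: measurable_funM => //; exact: measurable_inv_primitive_ratio_div.
rewrite /= in_itv/= andbT => u1; have u0 : 0 < u by exact: lt_le_trans u1.
suff -> : x * (u^-1 * primitive_ratio (sexp A) (x / u)) = `|primitive (sexp A) (x / u)|.
  by rewrite normr_ge0 lexx.
by rewrite /primitive_ratio; field; rewrite !gt_eqF.
Qed.

Lemma primitive_ratio_sexp_add_logdecay_le A B a : 0 < a -> a <= 1 ->
  (exists2 C, 0 <= C & forall x, 1 <= x ->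
    primitive_ratio (sexp A) x <= C * logdecay a x) ->
  (fun x : R => mass (sabs B) x : R^o) =o_+oo (fun x : R => x / ln x : R^o) ->
  exists2 C, 0 <= C & forall x, 1 <= x ->
    primitive_ratio (sexp (sadd A B)) x <= C * logdecay (a / 4) x.
Proof.
move=> a0 a1 [C C0 ratio_le] massB.
have [K K0 logkernel_le] := integral_sexp_logkernel_le massB a0 a1.
exists (C * K) => [|x x1]; first by rewrite mulr_ge0.
have x0 : 0 < x by exact: lt_le_trans x1.
have nk := nnmfun_logkernel_restrict a x.
have k0 u : 0 <= (logkernel a x \_ `[1, x]) u by case: nk => _ /(_ u); rewrite lee_fin.
rewrite -lee_fin; apply: (le_trans (primitive_ratio_sexp_add_le A B x0)).
apply: (@le_trans _ _ (\int[sabs (sexp B)]_(u in `[1%R, +oo[)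
    (C * (logkernel a x \_ `[1, x]) u)%:E)%E).
  apply: le_integral_EFin => // [||u].
  - exact: measurable_inv_primitive_ratio_div.
  - by apply: measurable_funM => //; apply/measurable_EFinP; case: nk.
  rewrite /= in_itv/= andbT => u1; have u0 : 0 < u by exact: lt_le_trans u1.
  rewrite mulr_ge0 ?primitive_ratio_ge0 ?ge1_invr_ge0//=.
  have [ux|xu] := leP u x; last first.
    by rewrite primitive_ratio_lt1 ?ltr_pdivrMr ?mul1r// mulr0 mulr_ge0.
  rewrite patchE mem_set/= ?in_itv/= ?u1// /logkernel [leRHS]mulrCA.
  rewrite ler_wpM2l ?ge1_invr_ge0// ratio_le//.
  by rewrite ler_pdivlMr ?mul1r.
rewrite ge0_integral_EFinZl//; last by apply/measurable_EFinP; case: nk.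
rewrite -(lfm_integralE _ nk) -integral_EFin_mkcond -mulrA EFinM.
by rewrite lee_wpmul2l ?lee_fin// logkernel_le.
Qed.

Lemma integral_inv_dilation_cvg0 (m : lfmeasure R) f (C : R) :
  measurable_fun [set: R] f -> (forall x, 0 <= f x <= C) ->
  f x @[x --> +oo] --> (0 : R) ->
  (\int[m]_(u in `[1%R, +oo[) (u^-1)%:E < +oo)%E ->
  (\int[m]_(u in `[1%R, +oo[) (u^-1 * f (x / u))%:E)%E @[x --> +oo] --> 0%E.
Proof.
move=> mf fC f0 inv_fin; apply/cvge_pinftyP => x x_oo.
have minv D : measurable_fun D (fun u : R => (u^-1)%:E).
  by apply/measurable_EFinP/measurable_funTS; exact: measurable_invr.
have inv_ge0 u : `[1, +oo[%classic u -> 0 <= u^-1 :> R.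
  by rewrite /= in_itv/= andbT; exact: ge1_invr_ge0.
rewrite -[X in _ --> X](integral0 m `[1, +oo[%classic).
apply: (@dominated_cvg _ _ _ m _ (measurable_itv `[1, +oo[)
  (fun n u => (u^-1 * f (x n / u))%:E) (cst 0%E) (fun u => (C%:E * (u^-1)%:E)%E)).
- move=> n; apply/measurable_EFinP/measurable_funTS; apply: measurable_funM.
    exact: measurable_invr.
  exact: (measurableT_comp mf (measurable_divr _)).
- move=> u u1; have u0 : 0 < u^-1.
    by rewrite invr_gt0 (lt_le_trans ltr01)//; move: u1; rewrite /= in_itv/= andbT.
  have fu0 : f (y / u) @[y --> +oo] --> (0 : R).
    exact: cvg_comp (gt0_cvgMly u0 cvg_id) f0.
  apply: cvg_EFin; first exact: nearW.
  rewrite -[X in _ --> X](mulr0 u^-1); apply: cvgMr.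
  exact: ((cvg_pinftyP _ _).1 fu0).
- by [].
- apply: integrableZl => //; apply/integrableP; split=> //.
  under eq_integral => u u1 do rewrite gee0_abs ?lee_fin ?(inv_ge0 _ (set_mem u1))//.
  exact: inv_fin.
- move=> n u u1; have /andP[fu0 fuC] := fC (x n / u).
  have iu0 := inv_ge0 u u1.
  by rewrite gee0_abs ?lee_fin ?mulr_ge0// mulrC ler_wpM2r.
Qed.

Lemma primitive_sexp_add_littleo A B :
  (fun x : R => primitive (sexp A) x : R^o) =o_+oo (fun x : R => x : R^o) ->
  (\int[sabs B]_(u in `[1%R, +oo[) (u^-1)%:E < +oo)%E ->
  (fun x : R => primitive (sexp (sadd A B)) x : R^o) =o_+oo (fun x : R => x : R^o).
Proof.
move=> Ao /integral_sexp_inv_lt_pinfty inv_fin.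
have AO : (fun x : R => primitive (sexp A) x : R^o) =O_+oo (fun x : R => x : R^o).
  by rewrite Ao.
have [C C0 A_le] := primitive_bigO_le (fun _ => id) AO.
have ratio_bounded x : 0 <= primitive_ratio (sexp A) x <= C.
  rewrite primitive_ratio_ge0/=; have [/primitive_ratio_lt1-> //|x1] := ltP x 1.
  by rewrite ler_pdivrMr ?(lt_le_trans ltr01)// A_le.
have ratio_cvg0 : primitive_ratio (sexp A) x @[x --> +oo] --> (0 : R).
  exact/littleo_idP.
have /fine_cvgP[I_fin I_cvg0] := integral_inv_dilation_cvg0
  (measurable_primitive_ratio _) ratio_bounded ratio_cvg0 inv_fin.
apply/littleo_idP; apply: (squeeze_cvgr _ (cvg_cst 0) I_cvg0); near=> x.
have x0 : 0 < x by near: x; apply: nbhs_pinfty_gt; rewrite num_real.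
rewrite primitive_ratio_ge0/= -lee_fin fineK; last by near: x.
exact: primitive_ratio_sexp_add_le.
Unshelve. all: by end_near. Qed.

Lemma primitive_sexp_add_small_mass_littleo A B a : 0 < a ->
  (fun x : R => primitive (sexp A) x : R^o) =O_+oo (fun x : R => x / (ln x) `^ a : R^o) ->
  (fun x : R => mass (sabs B) x : R^o) =o_+oo (fun x : R => x / ln x : R^o) ->
  (fun x : R => primitive (sexp (sadd A B)) x : R^o) =o_+oo (fun x : R => x : R^o).
Proof.
move=> a0 AO_a massB; have := bigO_div_powR_logdecay a0 AO_a; set b := Num.min a 1 => AO.
have b0 : 0 < b by rewrite lt_min a0 ltr01.
have b1 : b <= 1 by rewrite ge_min lexx orbT.
have [C C0 A_le] := primitive_bigO_le (fun x => ge1_mul_logdecay (ltW b0) b1) AO.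
have ratio_le : exists2 C, 0 <= C & forall x, 1 <= x ->
    primitive_ratio (sexp A) x <= C * logdecay b x.
  exists C => // x x1; have x0 : 0 < x by exact: lt_le_trans x1.
  by rewrite ler_pdivrMr// -mulrA [_ * x]mulrC A_le.
have [K K0 sum_ratio_le] :=
  primitive_ratio_sexp_add_logdecay_le b0 b1 ratio_le massB.
apply/littleo_idP.
have decay_cvg0 : K * logdecay (b / 4) x @[x --> +oo] --> (0 : R).
  rewrite -[X in _ --> X](mulr0 K); apply: cvgMr.
  by apply: logdecay_cvg0; rewrite divr_gt0.
apply: (squeeze_cvgr _ (cvg_cst 0) decay_cvg0); near=> x.
have x1 : 1 <= x by near: x; apply: nbhs_pinfty_ge; rewrite num_real.
by rewrite primitive_ratio_ge0/= sum_ratio_le.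
Unshelve. all: by end_near. Qed.

End perturbation.

Section jordan_decomposition.
Local Open Scope ereal_scope.
Context {R : realType}.
Variable A : smeasure R.

Let hahn n := projT2 (cid (projT2 (cid (Hahn_decomposition (spiece A n))))).
Let jpos n : {measure set R -> \bar R} := jordan_pos (hahn n).
Let jneg n : {measure set R -> \bar R} := jordan_neg (hahn n).
Let mpos : {measure set R -> \bar R} := mseries jpos 0.
Let mneg : {measure set R -> \bar R} := mseries jneg 0.

Let mposDmneg X : mpos X + mneg X = mvar A X.
Proof. by rewrite -[LHS]nneseriesD. Qed.

Let mpos_le X : mpos X <= mvar A X. Proof. by rewrite -mposDmneg leeDl. Qed.
Let mneg_le X : mneg X <= mvar A X. Proof. by rewrite -mposDmneg leeDr. Qed.

Let mpos_fin (x : R) : mpos `[1%R, x]%classic < +oo.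
Proof. exact: le_lt_trans (mpos_le _) (svar_fin A x). Qed.

Let mneg_fin (x : R) : mneg `[1%R, x]%classic < +oo.
Proof. exact: le_lt_trans (mneg_le _) (svar_fin A x). Qed.

Let mpos_supp : mpos `]-oo, 1%R[%classic = 0.
Proof. by apply/eqP; rewrite eq_le measure_ge0 andbT -(svar_supp A) mpos_le. Qed.

Let mneg_supp : mneg `]-oo, 1%R[%classic = 0.
Proof. by apply/eqP; rewrite eq_le measure_ge0 andbT -(svar_supp A) mneg_le. Qed.

Let lfm_piece_jordan n X : measurable X ->
  lfm_piece (spos A) n X + jneg n X = jpos n X + lfm_piece (sneg A) n X.
Proof.
move=> mX.
have : lfm_piece (spos A) n X - lfm_piece (sneg A) n X = jpos n X - jneg n X.
  rewrite -[LHS]/(spiece A n X).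
  by rewrite (jordan_decomp (hahn n) mX) /cadd/= cscaleN1.
have /fineK <- := lfm_piece_fin (spos A) n mX.
have /fineK <- := lfm_piece_fin (sneg A) n mX.
have /fineK <- : jpos n X \is a fin_num by exact: fin_num_measure.
have /fineK <- : jneg n X \is a fin_num by exact: fin_num_measure.
rewrite -!EFinB -!EFinD => -[piecesE]; congr EFin.
by apply/eqP; rewrite -subr_eq addrAC piecesE subrK.
Qed.

Lemma smeasure_jordan : exists2 J : smeasure R,
  (forall X, sabs J X = svar A X) & smeasure_eq A J.
Proof.
exists (SMeasure (LFMeasure mpos_fin mpos_supp) (LFMeasure mneg_fin mneg_supp)) => X.
  by rewrite lfm_addE; exact: mposDmneg.
move=> mX; rewrite (lfm_pieces _ mX) [X in _ = _ + X](lfm_pieces _ mX) /=.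
rewrite -[LHS]nneseriesD// -[RHS]nneseriesD//.
by apply: eq_eseriesr => n _; exact: lfm_piece_jordan.
Qed.

End jordan_decomposition.

Lemma sabs_sopp (R : realType) (A : smeasure R) X : sabs (sopp A) X = sabs A X.
Proof. by rewrite !lfm_addE addeC. Qed.

Theorem theorem1p1 (R : realType) (Pi0 E Rem : smeasure R)
  (h1 : exists2 a : R, 0 < a &
     (fun x : R => primitive (sexp (sopp Pi0)) x : R^o)
       =O_+oo (fun x : R => x / (ln x) `^ a : R^o))
  (h2 : (fun x : R => fine (svar E `[1%R, x]%classic) : R^o)
       =o_+oo (fun x : R => x / ln x : R^o))
  (h3 : (\int[svar Rem]_(u in `[1%R, +oo[) (u^-1)%:E < +oo)%E) :
  (fun x : R => primitive (sexp (sopp (sadd (sadd Pi0 E) Rem))) x : R^o)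
    =o_+oo (fun x : R => x : R^o).
Proof.
have [a a0 Pi0O] := h1.
have [E' E'var EE'] := smeasure_jordan E; have [R' R'var RR'] := smeasure_jordan Rem.
have -> : primitive (sexp (sopp (sadd (sadd Pi0 E) Rem))) =
    primitive (sexp (sadd (sadd (sopp Pi0) (sopp E')) (sopp R'))).
  apply: eq_primitive_sexp; apply: (@smeasure_eq_sopp _ _ (sadd (sadd Pi0 E') R')).
  by do 2 apply: smeasure_eq_sadd => //; exact: smeasure_eq_refl.
apply: primitive_sexp_add_littleo.
  apply: (primitive_sexp_add_small_mass_littleo a0 Pi0O).
  have -> // : mass (sabs (sopp E')) = fun x => fine (svar E `[1%R, x]%classic).
  by apply/funext => x; rewrite /mass sabs_sopp E'var.
rewrite (eq_measure_integral (svar Rem))// => X mX _.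
by rewrite -R'var -sabs_sopp.
Qed.
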